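(* Let $k\geq 2$. In the theory $\mathrm{CPS}_k$ there is a proper cycle of types \[ p_0(x;y)\rightsquigarrow p_1(x;y)\rightsquigarrow \cdots \rightsquigarrow p_{k-1}(x;y)\rightsquigarrow p_0(x;y)\] in which both $x$ and $y$ are single variables (tuples of length $1$). In particular, $\mathrm{CPS}_k$ is not equational.
   Context: Free pseudospace. A geometry is a graph whose vertices have levels $0$ (points), $1$ (lines) and $2$ (planes), with edges only between points and lines and between lines and planes. A flag is a path $a-b-c$ with $a$ a plane, $b$ a line, $c$ a point; we say $b$ lies in $a$, $c$ lies on $b$, and $c$ lies in $a$ if some line of $a$ passes through $c$. A letter is a non-empty subinterval $s$ of $\{0,1,2\}$. Given a flag $F$ in a geometry $A$, applying the operation $s$ to $F$ yields a geometry $B\supseteq A$ by freely adding a new flag $G$ whose vertices at levels in $s$ are new and which agrees with $F$ at the levels outside $s$ (only the edges needed for $G$ to be a flag are added). The free pseudospace $\mathbb M$ is obtained from a single flag by successively applying, countably many times, all these operations to all flags; $\mathrm{PS}$ is its complete first-order theory (in the language of the leveled graph). Coloured pseudospace. Fix $k\geq 2$; indices are taken mod $k$. The language is that of $\mathrm{PS}$ together with unary predicates $C_0,\dots,C_{k-1}$ partitioning the set of lines, and binary predicates $I_0,\dots,I_{k-1}$ partitioning the set of pairs $(a,c)$ with $a$ a plane and $c$ a point lying in $a$; $I_i(a)$ denotes the set of points $c$ with $I_i(a,c)$. $\mathrm{CPS}_k$ is the theory with axioms: the axioms of $\mathrm{PS}$; for each $i<k$, if a line $b$ of colour $i$ (i.e.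 in $C_i$) lies in a plane $a$, then all points on $b$ lie in $I_i(a)$ except at most one, which lies in $I_{i+1}(a)$; every line $b$ in a plane $a$ contains such an exceptional point, denoted $\mathrm{expt}(a,b)$; for each $i<k$, whenever $I_i(a,c)$, there are infinitely many lines in $a$ through $c$ of colour $i$ and infinitely many of colour $i-1$; for every point $c$ on a line $b$ there are infinitely many planes $a$ containing $b$ with $c=\mathrm{expt}(a,b)$. This theory is complete. Cycles. Working in a sufficiently saturated model of a complete theory $T$: for complete types $p(x,y)$, $q(x,y)$ over $\emptyset$ with the variables partitioned into $x$ and $y$ (written $p(x;y)$), write $p(x;y)\rightsquigarrow q(x;y)$ if there are a tuple $b$ and an indiscernible sequence $(a_i)_{i\in\mathbb N}$ with $\models p(a_i,b)$ for all $i>0$ and $\models q(a_0,b)$. A cycle of types is a sequence $p_0\rightsquigarrow p_1\rightsquigarrow\cdots\rightsquigarrow p_{n-1}\rightsquigarrow p_0$; it is proper if the $p_i$ are pairwise distinct. A formula $\varphi(x;y)$ is an equation if in every model of $T$ the family of finite intersections of instances $\varphi(x,b)$ has the descending chain condition; $T$ is equational if every formula is equivalent modulo $T$ to a Boolean combination of equations. *)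

(* Defs.v *)
From mathcomp Require Import all_boot.
From mathcomp Require Import boolp classical_sets cardinality.

Set Implicit Arguments.
Unset Strict Implicit.
Unset Printing Implicit Defensive.

Local Open Scope classical_set_scope.

Record signature := Signature { symbol :> Type; arity : symbol -> nat }.

Record structure (L : signature) := Structure {
  dom :> Type;
  interp : forall r : L, (arity r).-tuple dom -> Prop }.

(* [formula L V]: formulas whose free variables belong to the type [V].  A
   quantifier binds [None]; the variables of the context become [Some x]. *)
Inductive formula (L : signature) (V : Type) : Type :=
| Bot
| Eq (x y : V)
| Rel (r : L) (t : (arity r).-tuple V)
| Imp (f g : formula L V)
| And (f g : formula L V)
| Or (f g : formula L V)
| All (f : formula L (option V))
| Ex (f : formula L (option V)).
Arguments Bot {L V}.
Arguments Eq {L V}.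
Arguments Rel {L V}.

Definition Not L V (f : formula L V) := Imp f Bot.
Definition Top L V : formula L V := Not Bot.
Arguments Top {L V}.

Declare Scope fo_scope.
Delimit Scope fo_scope with F.
Bind Scope fo_scope with formula.
Arguments Imp {L V} (f g)%_F.
Arguments And {L V} (f g)%_F.
Arguments Or {L V} (f g)%_F.
Arguments All {L V} f%_F.
Arguments Ex {L V} f%_F.
Notation "x == y" := (Eq x y) : fo_scope.
Notation "~~ f" := (Not f) : fo_scope.
Notation "f && g" := (And f g) : fo_scope.
Notation "f || g" := (Or f g) : fo_scope.
Notation "f ==> g" := (Imp f g) : fo_scope.

Fixpoint rename L V W (h : V -> W) (f : formula L V) : formula L W :=
  match f with
  | Bot => Bot
  | Eq x y => Eq (h x) (h y)
  | Rel r t => Rel r (map_tuple h t)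
  | Imp f g => Imp (rename h f) (rename h g)
  | And f g => And (rename h f) (rename h g)
  | Or f g => Or (rename h f) (rename h g)
  | All f => All (rename (omap h) f)
  | Ex f => Ex (rename (omap h) f)
  end.

Definition big_and L V (s : seq (formula L V)) := foldr (@And L V) Top s.
Definition big_or L V (s : seq (formula L V)) := foldr (@Or L V) Bot s.

(* There are at least [n] elements outside [ys], pairwise distinct, satisfying
   [f]; the counted variable of [f] is [None]. *)
Fixpoint at_least L (n : nat) :
    forall V, seq V -> formula L (option V) -> formula L V :=
  match n with
  | 0 => fun _ _ _ => Top
  | n'.+1 => fun V ys f =>
      Ex (f && big_and [seq ~~ (None == Some y) | y <- ys]
            && at_least n' (None :: map Some ys) (rename (omap Some) f))%F
  end.

Fixpoint sat L (M : structure L) V (v : V -> M) (f : formula L V) : Prop :=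
  match f with
  | Bot => False
  | Eq x y => v x = v y
  | Rel r t => @interp L M r (map_tuple v t)
  | Imp f g => sat v f -> sat v g
  | And f g => sat v f /\ sat v g
  | Or f g => sat v f \/ sat v g
  | All f => forall a : M, sat (oapp v a) f
  | Ex f => exists a : M, sat (oapp v a) f
  end.

Definition sentence L := formula L void.
Definition theory L := set (sentence L).

Definition holds L (M : structure L) (s : sentence L) := sat (of_void M) s.
Definition model L (T : theory L) (M : structure L) := T `<=` holds M.

(* The parameters are the values of [c]; the variable of the type is [None].  For
   a countable language this is enough saturation for the notions below, which
   only involve countably many elements of the model. *)
Definition aleph1_saturated L (M : structure L) :=
  forall (c : nat -> M) (S : set (formula L (option nat))),
    (forall S0, S0 `<=` S -> finite_set S0 ->
       exists a : M, S0 `<=` sat (oapp c a)) ->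
    exists a : M, S `<=` sat (oapp c a).

Definition realizes L (M : structure L) V (v : V -> M)
  (p : set (formula L V)) := p `<=` sat v.

(* Over the empty set; consistency is finite satisfiability in [M]. *)
Definition complete_type L (M : structure L) V (p : set (formula L V)) :=
  (forall p0, p0 `<=` p -> finite_set p0 -> exists v : V -> M, realizes v p0) /\
  (forall f, p f \/ p (Not f)).

Definition indiscernible L (M : structure L) m (a : nat -> 'I_m -> M) :=
  forall (N : nat) (s t : 'I_N -> nat),
    {homo s : i j / i < j} -> {homo t : i j / i < j} ->
    forall f : formula L ('I_N * 'I_m),
      sat (fun z => a (s z.1) z.2) f <-> sat (fun z => a (t z.1) z.2) f.

(* The variables of a formula [f(x; y)] with [x] of length [m] and [y] of length
   [n] are indexed by ['I_m + 'I_n]. *)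
Definition join (A : Type) m n (a : 'I_m -> A) (b : 'I_n -> A)
    (z : 'I_m + 'I_n) : A :=
  match z with inl i => a i | inr j => b j end.

Definition leads_to L (M : structure L) m n
    (p q : set (formula L ('I_m + 'I_n))) :=
  exists (b : 'I_n -> M) (a : nat -> 'I_m -> M),
    [/\ indiscernible a,
        forall i, 0 < i -> realizes (join (a i) b) p
      & realizes (join (a 0) b) q].

Definition proper_cycle L (M : structure L) m n l
    (p : 'I_l -> set (formula L ('I_m + 'I_n))) :=
  [/\ forall i, complete_type M (p i),
      forall i, leads_to M (p i) (p (ordS i))
    & injective p].

(* [T] is meant to be complete; the choice of the saturated model is then
   irrelevant. *)
Definition has_proper_cycle L (T : theory L) (m n l : nat) :=
  exists M : structure L, [/\ model T M, aleph1_saturated M &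
    exists p : 'I_l -> set (formula L ('I_m + 'I_n)), proper_cycle M p].

Definition descending_chain_condition A (F : set (set A)) :=
  forall X : nat -> set A,
    (forall i, F (X i)) -> (forall i, X i.+1 `<=` X i) ->
    exists N, forall i, N <= i -> X i = X N.

Definition finite_intersections L (M : structure L) m n
    (f : formula L ('I_m + 'I_n)) : set (set ('I_m -> M)) :=
  [set X | exists2 B : set ('I_n -> M), finite_set B &
     X = \bigcap_(b in B) [set a | sat (join a b) f]].

Definition equation L (T : theory L) m n (f : formula L ('I_m + 'I_n)) :=
  forall M, model T M ->
    descending_chain_condition (@finite_intersections L M m n f).

Inductive boolean_combination L V (E : set (formula L V)) : set (formula L V) :=
| bc_base f : E f -> boolean_combination E f
| bc_bot : boolean_combination E Bot
| bc_not f : boolean_combination E f -> boolean_combination E (Not f)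
| bc_and f g : boolean_combination E f -> boolean_combination E g ->
    boolean_combination E (And f g)
| bc_or f g : boolean_combination E f -> boolean_combination E g ->
    boolean_combination E (Or f g).

Definition equivalent_mod L (T : theory L) V (f g : formula L V) :=
  forall M, model T M -> forall v : V -> M, sat v f <-> sat v g.

Definition equational L (T : theory L) :=
  forall m n (f : formula L ('I_m + 'I_n)),
    exists2 g, boolean_combination (@equation L T m n) g & equivalent_mod T f g.

Definition point_level : 'I_3 := @Ordinal 3 0 isT.
Definition line_level : 'I_3 := @Ordinal 3 1 isT.
Definition plane_level : 'I_3 := @Ordinal 3 2 isT.

Inductive ps_symbol := Level of 'I_3 | Edge.

Definition ps_sig := @Signature ps_symbol
  (fun r => match r with Level _ => 1 | Edge => 2 end).

(* Names for the vertices.  [Start l] is the vertex of level [l] of the initial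
   flag.  [New j a b c lo hi l] is the vertex of level [l] which is added when the
   letter [lo, hi] is applied to the flag [a - b - c] for the [j]-th time. *)
Inductive vertex :=
| Start of 'I_3
| New of nat & vertex & vertex & vertex & 'I_3 & 'I_3 & 'I_3.

Definition level (u : vertex) : 'I_3 :=
  match u with Start l => l | New _ _ _ _ _ _ l => l end.

(* The vertex of level [l] of the flag [G] produced by such an application. *)
Definition new_flag (j : nat) (a b c : vertex) (lo hi l : 'I_3) : vertex :=
  if (lo <= l <= hi)%N then New j a b c lo hi l
  else if l == plane_level then a else if l == line_level then b else c.

Definition consecutive (l l' : 'I_3) := (l.+1 == l' :> nat) || (l'.+1 == l :> nat).

Inductive adjacent : vertex -> vertex -> Prop :=
| adj_start l l' : consecutive l l' -> adjacent (Start l) (Start l')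
| adj_new j a b c (lo hi l l' : 'I_3) : lo <= l <= hi -> consecutive l l' ->
    adjacent (New j a b c lo hi l) (new_flag j a b c lo hi l')
| adj_sym u u' : adjacent u u' -> adjacent u' u.

Definition flag (a b c : vertex) :=
  [/\ level a = plane_level, level b = line_level, level c = point_level,
      adjacent a b & adjacent b c].

(* The names which denote vertices: operations are only applied to flags. *)
Inductive built : vertex -> Prop :=
| built_start l : built (Start l)
| built_new j a b c (lo hi l : 'I_3) :
    built a -> built b -> built c -> flag a b c -> lo <= l <= hi ->
    built (New j a b c lo hi l).

Definition free_pseudospace : structure ps_sig :=
  @Structure ps_sig {u : vertex | built u}
    (fun r => match r with
     | Level l => fun t : 1.-tuple {u | built u} => level (sval (tnth t ord0)) = l
     | Edge => fun t : 2.-tuple {u | built u} =>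
         adjacent (sval (tnth t ord0)) (sval (tnth t ord_max))
     end).

Definition PS : theory ps_sig := [set s | holds free_pseudospace s].

Inductive cps_symbol (k : nat) :=
| Geo of ps_symbol
| Colour of 'I_k
| Incidence of 'I_k.
Arguments Geo {k}.

Definition cps_sig (k : nat) := @Signature (cps_symbol k)
  (fun r => match r with
   | Geo r' => @arity ps_sig r' | Colour _ => 1 | Incidence _ => 2 end).

Fixpoint lift_ps k V (f : formula ps_sig V) : formula (cps_sig k) V :=
  match f with
  | Bot => Bot
  | Eq x y => Eq x y
  | Rel r t => @Rel (cps_sig k) V (Geo r) t
  | Imp f g => Imp (lift_ps k f) (lift_ps k g)
  | And f g => And (lift_ps k f) (lift_ps k g)
  | Or f g => Or (lift_ps k f) (lift_ps k g)
  | All f => All (lift_ps k f)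
  | Ex f => Ex (lift_ps k f)
  end.

Section CPS.
Variable k : nat.

Section Formulas.
Variable V : Type.
Local Notation formula := (formula (cps_sig k) V).

Definition Lev (l : 'I_3) (x : V) : formula :=
  @Rel (cps_sig k) V (Geo (Level l)) [tuple x].
Definition Edg (x y : V) : formula :=
  @Rel (cps_sig k) V (Geo Edge) [tuple x; y].
Definition Col (i : 'I_k) (b : V) : formula :=
  @Rel (cps_sig k) V (Colour i) [tuple b].
Definition Inc (i : 'I_k) (a c : V) : formula :=
  @Rel (cps_sig k) V (Incidence i) [tuple a; c].

Definition line_in (b a : V) : formula :=
  (Lev line_level b && Lev plane_level a && Edg a b)%F.
Definition point_on (c b : V) : formula :=
  (Lev point_level c && Lev line_level b && Edg b c)%F.

(* [c = expt(a, b)] *)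
Definition is_expt (a b c : V) : formula :=
  (line_in b a && point_on c b
     && big_or [seq Col i b && Inc (ordS i) a c | i <- enum 'I_k])%F.
End Formulas.

Definition point_in V (c a : V) : formula (cps_sig k) V :=
  Ex (line_in None (Some a) && point_on (Some c) None)%F.

Local Notation x0 := None.
Local Notation x1 := (Some None).
Local Notation x2 := (Some (Some None)).
Local Notation x3 := (Some (Some (Some None))).

(* Under the quantifiers the variables are numbered from the innermost one.  The
   indices of the colours are taken mod [k] by means of [ordS] and [ord_pred]. *)
Inductive CPS : theory (cps_sig k) :=
| cps_ps s : PS s -> CPS (lift_ps k s)
| cps_col_line i : CPS (All (Col i x0 ==> Lev line_level x0))
| cps_col_cover :
    CPS (All (Lev line_level x0 ==> big_or [seq Col i x0 | i <- enum 'I_k]))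
| cps_col_disj i j : i != j -> CPS (All (~~ (Col i x0 && Col j x0)))
| cps_inc_in i : CPS (All (All (Inc i x1 x0 ==> point_in x0 x1)))
| cps_inc_cover :
    CPS (All (All (point_in x0 x1 ==> big_or [seq Inc i x1 x0 | i <- enum 'I_k])))
| cps_inc_disj i j : i != j -> CPS (All (All (~~ (Inc i x1 x0 && Inc j x1 x0))))
  (* plane x1, line x0 of colour i; then plane x2, line x1, point x0;
     then plane x3, line x2, points x1 and x0 *)
| cps_line i :
    CPS (All (All (line_in x0 x1 && Col i x0 ==>
      All (point_on x0 x1 ==> Inc i x2 x0 || Inc (ordS i) x2 x0)
      && All (All (point_on x1 x2 && point_on x0 x2
                   && ~~ Inc i x3 x1 && ~~ Inc i x3 x0 ==> (x1 == x0))))))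
| cps_expt : CPS (All (All (line_in x0 x1 ==> Ex (is_expt x2 x1 x0))))
  (* plane x1, point x0; then plane x2, point x1, line x0 *)
| cps_lines i n :
    CPS (All (All (Inc i x1 x0 ==>
      at_least n [::] (line_in x0 x2 && point_on x1 x0 && Col i x0))))
| cps_lines_pred i n :
    CPS (All (All (Inc i x1 x0 ==>
      at_least n [::] (line_in x0 x2 && point_on x1 x0 && Col (ord_pred i) x0))))
  (* line x1, point x0; then line x2, point x1, plane x0 *)
| cps_planes n :
    CPS (All (All (point_on x0 x1 ==> at_least n [::] (is_expt x0 x2 x1)))).
End CPS.
Arguments CPS : clear implicits.

(* Main.v *)
(* The free pseudospace itself is coloured, by recursion on the names of its
   vertices, so that the axioms of PS hold trivially.  The exceptional point
   of a line in a plane is prescribed by the name of the younger of the two, and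
   the colour of a line which is added to a flag by the letter {1} is then forced,
   up to the parity of the index of the application, by the colour of the line of
   this flag.

   A set of vertices is strong if the pseudospace is obtained from it by free
   extensions in which every new incident pair (plane, line) gets its exceptional
   point at once.  As free extensions commute, isomorphisms between strong sets
   form a back-and-forth system.  Hence all strong flags a - b - c with
   c = expt(a, b) and b of colour i have the same type, and so tp(c, a) depends
   only on i; call it p_i.  If d is an ordinary point of a line b of colour i + 1 in
   a, a new line of colour i in a with exceptional point d shows that (d, a)
   realizes p_i, while (expt(a, b), a) realizes p_{i+1}.  The points of b are
   indiscernible since any two increasing tuples of them extend, together with b,
   to isomorphic strong sets.  This gives the cycle in the coloured pseudospace and
   therefore in its ultrapowers, which are aleph_1-saturated.

   With one plane a_n for each point c_n of b such that c_n = expt(a_n, b), an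
   equation in p_i but not in p_{i+1} would violate the descending chain condition.
   So the p_i contain the same equations, although I_{i+1} distinguishes p_i. *)

Require Import Defs.
From mathcomp Require Import all_boot.
From mathcomp Require Import boolp classical_sets cardinality filter.
From Stdlib Require List.

Set Implicit Arguments.
Unset Strict Implicit.
Unset Printing Implicit Defensive.

Local Open Scope classical_set_scope.
Local Open Scope card_scope.

(** * Model theory *)

Section Satisfaction.
Variables (L : signature) (M : structure L).

Lemma sat_ext V (v w : V -> M) (f : formula L V) :
  v =1 w -> sat v f <-> sat w f.
Proof. by move=> /funext->. Qed.

Lemma sat_rename V W (h : V -> W) (f : formula L V) (v : W -> M) :
  sat v (rename h f) <-> sat (v \o h) f.
Proof.
elim: f W h v => {V} [V|V x y|V r t|V f IHf g IHg|V f IHf g IHg|V f IHf g IHg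
  |V f IHf|V f IHf] W h v //=.
- rewrite (_ : map_tuple v (map_tuple h t) = map_tuple (v \o h) t) //.
  by apply: val_inj; rewrite /= -map_comp.
- by rewrite IHf IHg.
- by rewrite IHf IHg.
- by rewrite IHf IHg.
- split=> H a; have := H a; rewrite IHf; congr sat; apply/funext;
    by case=> [x|].
- split=> -[a H]; exists a; move: H; rewrite IHf; congr sat; apply/funext;
    by case=> [x|].
Qed.

Lemma sat_big_or V (v : V -> M) (I : eqType) (s : seq I) (F : I -> formula L V) :
  sat v (big_or [seq F i | i <- s]) <-> exists2 i, i \in s & sat v (F i).
Proof.
elim: s => [|i s IH] /=; first by split=> // -[].
rewrite IH; split=> [[Fi|[j js Fj]]|[j]].
- by exists i => //; rewrite mem_head.
- by exists j => //; rewrite inE js orbT.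
- by rewrite inE => /orP[/eqP->|js Fj]; [left|right; exists j].
Qed.

Lemma sat_big_or_enum V (v : V -> M) (I : finType) (F : I -> formula L V) :
  sat v (big_or [seq F i | i <- enum I]) <-> exists i, sat v (F i).
Proof.
rewrite sat_big_or; split=> [[i _ Fi]|[i Fi]]; exists i => //.
by rewrite mem_enum.
Qed.

Lemma injective_avoids (T : Type) (g : nat -> T) (xs : seq T) : injective g ->
  exists N, forall n, N <= n -> ~ List.In (g n) xs.
Proof.
move=> ginj; elim: xs => [|x xs [N HN]]; first by exists 0 => n _ [].
have [[m gm]|nog] := pselect (exists m, g m = x).
  exists (maxn N m.+1) => n; rewrite geq_max => /andP[Nn mn] /= [gn|]; last exact: (HN n Nn).
  have mE : m = n by apply: ginj; rewrite gm.
  by rewrite mE ltnn in mn.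
by exists N => n Nn /= [gn|]; [apply: nog; exists n|exact: HN].
Qed.

(** An injective sequence of solutions leaves every finite list, so at each stage of [at_least] a
    solution different from the earlier choices remains. *)
Lemma sat_at_least n (V : Set) (v : V -> M) ys (f : formula L (option V)) (g : nat -> M) :
  injective g -> (forall m, sat (oapp v (g m)) f) -> sat v (at_least n ys f).
Proof.
move=> ginj; elim: n V v ys f => [|n IH] V v ys f fg /=; first by [].
have [N /(_ N (leqnn N)) gN] := injective_avoids [seq v y | y <- ys] ginj.
exists (g N); split; [split; first exact: fg|].
  elim: ys gN => [|y ys IHys] /= gN; first by [].
  split.
    by move=> /= e; apply: gN; left.
  by apply: IHys => H; apply: gN; right.
apply: IH => m; rewrite sat_rename; move: (fg m).
by congr sat; apply/funext; case.
Qed.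

End Satisfaction.

(** Induction on the formula, for all relations of the system at once: a quantifier replaces [R] by
    an extension that covers the new element. The relations may be infinite, and one extension may
    add many other elements. *)
Lemma back_and_forth L (M M' : structure L) (F : set (M -> M' -> Prop)) :
  (forall R, F R -> forall x x' y y', R x x' -> R y y' -> (x = y <-> x' = y')) ->
  (forall R, F R -> forall r (t : (arity r).-tuple M) (t' : (arity r).-tuple M'),
     (forall i, R (tnth t i) (tnth t' i)) -> interp t <-> interp t') ->
  (forall R, F R -> forall x, exists2 R', F R' &
     (forall y y', R y y' -> R' y y') /\ exists x', R' x x') ->
  (forall R, F R -> forall x', exists2 R', F R' &
     (forall y y', R y y' -> R' y y') /\ exists x, R' x x') ->
  forall R, F R -> forall V (f : formula L V) (v : V -> M) (v' : V -> M'),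
    (forall x, R (v x) (v' x)) -> sat v f <-> sat v' f.
Proof.
move=> Feq Frel forth back R FR V f.
elim: f R FR => {V} [V|V x y|V r t|V f IHf g IHg|V f IHf g IHg|V f IHf g IHg
  |V f IHf|V f IHf] R FR v v' vv' //=.
- exact: (Feq R FR).
- by apply: (Frel R FR) => i; rewrite !tnth_map.
- by rewrite (IHf R FR v v') // (IHg R FR v v').
- by rewrite (IHf R FR v v') // (IHg R FR v v').
- by rewrite (IHf R FR v v') // (IHg R FR v v').
- split=> H a.
    have [R' FR' [RR' [x Rx]]] := back _ FR a.
    by rewrite -(IHf R' FR' (oapp v x)) //; case=> [y|] //=; apply: RR'.
  have [R' FR' [RR' [x Rx]]] := forth _ FR a.
  by rewrite (IHf R' FR' _ (oapp v' x)) //; case=> [y|] //=; apply: RR'.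
- split=> -[a H].
    have [R' FR' [RR' [x Rx]]] := forth _ FR a.
    exists x; rewrite -(IHf R' FR' (oapp v a)) //; case=> [y|] //=; exact: RR'.
  have [R' FR' [RR' [x Rx]]] := back _ FR a.
  by exists x; rewrite (IHf R' FR' _ (oapp v' a)) //; case=> [y|] //=; apply: RR'.
Qed.

(** * Numbering the formulas of a countable signature *)

Section Code.
Variables (L : signature) (c : symbol L -> nat).
Hypothesis c_inj : injective c.

(** Under a quantifier the bound variable gets the number 0 and the others are shifted by one, which
    keeps the numbering [e] injective. *)
Fixpoint code V (e : V -> nat) (f : formula L V) : GenTree.tree nat :=
  match f with
  | Bot => GenTree.Leaf 0
  | Eq x y => GenTree.Node 0 [:: GenTree.Leaf (e x); GenTree.Leaf (e y)]
  | Rel r t => GenTree.Node 1 [seq GenTree.Leaf n | n <- c r :: map e t]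
  | Imp f g => GenTree.Node 2 [:: code e f; code e g]
  | And f g => GenTree.Node 3 [:: code e f; code e g]
  | Or f g => GenTree.Node 4 [:: code e f; code e g]
  | All f => GenTree.Node 5 [:: code (oapp (S \o e) 0) f]
  | Ex f => GenTree.Node 6 [:: code (oapp (S \o e) 0) f]
  end.

Lemma code_inj V (e : V -> nat) : injective e -> injective (code e).
Proof.
move=> e_inj f.
elim: f e e_inj => {V} [V|V x y|V r t|V f IHf g IHg|V f IHf g IHg|V f IHf g IHg
  |V f IHf|V f IHf] e e_inj [|x' y'|r' t'|f' g'|f' g'|f' g'|f'|f'] //=.
- by move=> [/e_inj-> /e_inj->].
- move=> [/c_inj rr']; case: _ / rr' t' => t' H; congr Rel.
  apply: val_inj; apply: (inj_map e_inj); apply: (inj_map _ H).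
  by move=> m n [].
- by move=> [/(IHf _ e_inj)-> /(IHg _ e_inj)->].
- by move=> [/(IHf _ e_inj)-> /(IHg _ e_inj)->].
- by move=> [/(IHf _ e_inj)-> /(IHg _ e_inj)->].
- by move=> [/IHf->] // [x|] [y|] //= [/e_inj->].
- by move=> [/IHf->] // [x|] [y|] //= [/e_inj->].
Qed.

End Code.

(** * Ultrapowers over an ultrafilter on the natural numbers *)

Section Ultrapower.
Variables (L : signature) (M : structure L) (U : set_system nat).
Hypothesis U_ultra : UltraFilter U.

Lemma ultraC (A : set nat) : U (~` A) <-> ~ U A.
Proof.
split=> [nA uA|nA]; last by case: (in_ultra_setVsetC A U_ultra).
have /filter_ex[n []] : U (A `&` ~` A) by exact: filterI.
by [].
Qed.

Definition almost_eq (f g : nat -> M) : Prop := U [set i | f i = g i].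

Lemma almost_eq_sym f g : almost_eq f g -> almost_eq g f.
Proof. by apply: filterS => i /= ->. Qed.

Lemma almost_eq_trans f g h : almost_eq f g -> almost_eq g h -> almost_eq f h.
Proof. by move=> fg gh; apply: filterS2 fg gh => i /= -> ->. Qed.

Lemma almost_eqE f g : almost_eq f g -> almost_eq f = almost_eq g.
Proof.
move=> fg; apply/funext => h; apply/propext; split; apply: almost_eq_trans => //.
exact: almost_eq_sym.
Qed.

Lemma almost_eq_ex f : exists g, almost_eq f g.
Proof. by exists f; apply: filterE. Qed.

(* Depends on the class of [f] only, by propositional extensionality. *)
Definition canonical (f : nat -> M) : nat -> M := sval (cid (almost_eq_ex f)).

Lemma canonicalP f : almost_eq f (canonical f).
Proof. by rewrite /canonical; case: cid. Qed.

Lemma canonical_eq f g : almost_eq f g -> canonical f = canonical g.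
Proof.
move=> /almost_eqE fg; rewrite /canonical.
by move: (almost_eq_ex f) (almost_eq_ex g); rewrite fg => p q; rewrite (Prop_irrelevance p q).
Qed.

Definition ultra_dom := {f : nat -> M | canonical f = f}.

Definition cls (f : nat -> M) : ultra_dom :=
  exist _ (canonical f) (esym (canonical_eq (canonicalP f))).

Lemma cls_almost f : almost_eq (sval (cls f)) f.
Proof. exact/almost_eq_sym/canonicalP. Qed.

Lemma ultra_domP (x y : ultra_dom) : x = y <-> almost_eq (sval x) (sval y).
Proof.
split=> [->|]; first exact: filterE.
case: x y => [f fK] [g gK] /= /canonical_eq; rewrite fK gK => fg.
by case: _ / fg gK => gK; rewrite (Prop_irrelevance fK gK).
Qed.

Definition ultrapower : structure L := @Structure L ultra_dom
  (fun r t => U [set i | interp (map_tuple (fun x : ultra_dom => sval x i) t)]).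

(** Witnesses are chosen coordinate by coordinate; the canonical representative of the resulting
    sequence agrees with them on a set of [U]. *)
Lemma ultra_choice (P : nat -> M -> Prop) :
  U [set i | exists a, P i a] -> exists g : ultrapower, U [set i | P i (sval g i)].
Proof.
move=> uP; have /filter_ex[i0 [m0 _]] := uP.
have /choice[g gP] : forall i, exists a, (exists a, P i a) -> P i a.
  move=> i; have [[a Pa]|nP] := pselect (exists a, P i a); first by exists a.
  by exists m0.
exists (cls g); apply: filterS2 (cls_almost g) uP => i /= -> ; exact: gP.
Qed.

Lemma sat_coordinate V (f : formula L (option V)) (v : V -> ultrapower)
    (a : ultrapower) i :
  sat (oapp (fun x => sval (v x) i) (sval a i)) f <->
  sat (fun x => sval (oapp v a x) i) f.
Proof. by apply: sat_ext; case. Qed.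

Lemma Los V (f : formula L V) (v : V -> ultrapower) :
  sat v f <-> U [set i | sat (fun x => sval (v x) i) f].
Proof.
elim: f v => {V} [V|V x y|V r t|V f IHf g IHg|V f IHf g IHg|V f IHf g IHg
  |V f IHf|V f IHf] v /=.
- by split=> // /filter_ex[].
- exact: ultra_domP.
- suff -> : (fun i => interp (map_tuple ((fun x : ultra_dom => sval x i)) (map_tuple v t)))
    = (fun i => interp (map_tuple (fun x => sval (v x) i) t)) by [].
  apply/funext => i; congr interp; apply: val_inj.
  by rewrite /= -map_comp.
- rewrite IHf IHg; split=> [fg|fg uf]; last first.
    by apply: filterS2 fg uf => i /= h /h.
  have [uf|/ultraC] := pselect (U [set i | sat (fun x => sval (v x) i) f]).
    by apply: filterS (fg uf) => i ug _.
  by apply: filterS => i /= nf /nf.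
- rewrite IHf IHg; split=> [[uf ug]|fg]; first by apply: filterS2 uf ug.
  by split; apply: filterS fg => i [].
- rewrite IHf IHg; split=> [[|]|].
  + by apply: filterS => i uf; left.
  + by apply: filterS => i ug; right.
  + move=> fg; have [uf|/ultraC uf] := pselect (U [set i | sat (fun x => sval (v x) i) f]).
      by left.
    by right; apply: filterS2 fg uf => i /= [].
- split=> [H|H a]; last first.
    by rewrite IHf; apply: filterS H => i /= /(_ (sval a i)); rewrite sat_coordinate.
  (* If the universal statement failed at almost all coordinates, the counterexamples would form an
     element [g] of the ultrapower contradicting [H]. *)
  apply: contrapT => /ultraC uf.
  have [|g /(filterI _) ug] := @ultra_choice
      (fun i a => ~ sat (oapp (fun x => sval (v x) i) a) f).
    by apply: filterS uf => i /existsNP.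
  have := H g; rewrite IHf => /ug/filter_ex[i [/= sg]].
  by apply; rewrite sat_coordinate.
- split=> [[a]|/ultra_choice[g ug]].
    rewrite IHf; apply: filterS => i /=; rewrite -sat_coordinate => sa.
    by exists (sval a i).
  by exists g; rewrite IHf; apply: filterS ug => i /=; rewrite sat_coordinate.
Qed.

Definition diag (x : M) : ultrapower := cls (fun=> x).

(* For infinite [V] the constant representatives need not agree simultaneously
   with the canonical ones. *)
Lemma sat_diag (V : finType) (f : formula L V) (v : V -> M) :
  sat (diag \o v) f <-> sat v f.
Proof.
have uv : U [set i | forall x, sval (diag (v x)) i = v x].
  by apply: filter_forall => x; exact: cls_almost.
have vE i : (forall x, sval (diag (v x)) i = v x) ->
    sat (fun x => sval ((diag \o v) x) i) f <-> sat v f.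
  by move=> vE; apply: sat_ext.
rewrite Los; split=> [/(filterI uv)/filter_ex[i [/= /vE sv /sv]] //|vf].
by apply: filterS uv => i /vE sv; apply/sv.
Qed.

Hypothesis U_free : \oo `<=` U.

(** With the formulas of [S] numbered by [h], coordinate [i] chooses an element satisfying as long
    an initial segment of [S], of length at most [i], as is possible there. For each [f] in [S],
    almost every coordinate exceeds [h f] and can satisfy all formulas up to [f]; so the class of
    the choices realises [S]. *)
Lemma ultrapower_saturated (h : formula L (option nat) -> nat) :
  injective h -> aleph1_saturated ultrapower.
Proof.
move=> h_inj c S finsat.
pose c_ i x := sval (c x) i.
pose below n := [set f | S f /\ h f < n].
have finite_below n : finite_set (below n).
  apply: (@card_le_finite _ _ _ (h @` below n)); last first.
    by apply: (@sub_finite_set _ _ `I_n) => // _ [f [_ hf] <-].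
  have /card_esym : h @` below n #= below n.
    by apply: inj_card_eq => f g _ _ /h_inj.
  by rewrite card_eq_le => /andP[].
pose X n := [set i | exists a, forall f, below n f -> sat (oapp (c_ i) a) f].
have UX n : U (X n).
  have [|//|a sa] := finsat (below n); first by move=> f [].
  suff : U [set i | forall f, below n f -> sat (oapp (c_ i) (sval a i)) f].
    by apply: filterS => i Hi; exists (sval a i).
  (* [U] is closed under finite intersections, so the formulas of [below n] are handled one at a
     time; at most one of them has a given number. *)
  elim: n sa {finite_below} => [|n IH] sa.
    by apply: filterE => i f [].
  have /IH un : below n `<=` sat (oapp c a).
    by move=> f [Sf fn]; apply: sa; split=> //; apply: ltnW.
  have [[f0 [Sf0 hf0]]|nof] := pselect (exists f, S f /\ h f = n); last first.
    apply: filterS un => i Hi f [Sf]; rewrite ltnS leq_eqVlt => /orP[/eqP hf|hf].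
      by case: nof; exists f.
    exact: Hi.
  have : sat (oapp c a) f0 by apply: sa; split=> //; rewrite hf0.
  rewrite Los => u0; apply: filterS2 un u0 => i Hi H0 f [Sf].
  rewrite ltnS leq_eqVlt => /orP[/eqP hf|hf]; last exact: Hi.
  by rewrite (h_inj f f0) ?hf0 // sat_coordinate.
have [m0 _] : exists m0 : M, True.
  by have /filter_ex[i [m0 _]] := UX 0; exists m0.
have /choice[g gP] : forall i, exists a, forall n, n <= i -> X n i ->
    forall f, below n f -> sat (oapp (c_ i) a) f.
  move=> i; suff /(_ i) : forall N, exists a, forall n, n <= N -> X n i ->
    forall f, below n f -> sat (oapp (c_ i) a) f by [].
  (* The element for the largest admissible [n] serves all smaller ones, since [below] is
     increasing. *)
  elim=> [|N [a IH]].
    by exists m0 => n; rewrite leqn0 => /eqP-> _ f [].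
  have [[a' Ha']|nX] := pselect (X N.+1 i).
    exists a' => n nN _ f [Sf fn]; apply: Ha'; split=> //; exact: leq_trans nN.
  exists a => n; rewrite leq_eqVlt => /orP[/eqP->//|]; exact: IH.
exists (cls g) => f Sf; rewrite Los.
have Un : U [set i | h f < i] by apply: U_free; exists (h f).+1.
apply: filterS2 (filterI Un (UX (h f).+1)) (cls_almost g) => i [/= hi Xi] gi.
by rewrite -sat_coordinate /= gi; apply: gP hi Xi _ _.
Qed.

End Ultrapower.

(** * Equations along a cycle of types *)

Lemma ordS_closed k (P : 'I_k -> Prop) :
  (forall i, P i -> P (ordS i)) -> forall i j, P i -> P j.
Proof.
move=> PS i j Pi.
have itE n : val (iter n (@ordS k) i) = (i + n) %% k.
  elim: n => [|n IH]; first by rewrite addn0 modn_small.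
  by rewrite iterS /= IH -addn1 modnDml addn1 addnS.
(* From [i], the first [k - i] successors lead around to 0, and [j] more lead to [j]. *)
suff -> : j = iter (k - i + j) (@ordS k) i by elim: (k - i + j) => //= n; exact: PS.
by apply: val_inj; rewrite itE addnA subnKC ?modnDl ?modn_small // ltnW.
Qed.

(* An equation transfers from [p i] to [p (ordS i)]: otherwise the instances at
   [y i 0], ..., [y i n] cut out a strictly descending chain of sets, as
   [x i n.+1] separates two consecutive ones. *)
Lemma not_equational_of_cycle L (T : theory L) (M : structure L) k
    (p : 'I_k -> set (formula L ('I_1 + 'I_1))) (x y : 'I_k -> nat -> M) :
  model T M ->
  (forall i f m n, m != n ->
     sat (join (fun=> x i m) (fun=> y i n)) f <-> p i f) ->
  (forall i f n, sat (join (fun=> x i n) (fun=> y i n)) f <-> p (ordS i) f) ->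
  (exists i j f, p i f /\ ~ p j f) -> ~ equational T.
Proof.
move=> TM pE pSE [i [j [f [pif npjf]]]] /(_ 1 1 f)[g gE fg].
(* Each [p l] consists of the formulas true of one pair in [M], so membership in it respects the
   connectives and equivalence modulo [T]. *)
have pM l : exists v : 'I_1 + 'I_1 -> M, forall h, sat v h <-> p l h.
  by exists (join (fun=> x l 0) (fun=> y l 1)) => h; apply: pE.
suff : p i g <-> p j g.
  have [v vi] := pM i; have [w wj] := pM j.
  rewrite -vi -wj -(fg M TM) -(fg M TM) vi wj => -[/(_ pif) //].
elim: gE => [e eE||h _ IH|h h' _ IH _ IH'|h h' _ IH _ IH'].
- suff : forall l, p l e -> p (ordS l) e by move=> /ordS_closed H; split; apply: H.
  move=> l ple; apply: contrapT => npe.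
  pose X n := \bigcap_(b in [set fun _ : 'I_1 => y l m | m in `I_n.+1])
    [set a : 'I_1 -> M | sat (join a b) e].
have [|n|m /(_ m.+1 (leqnSn m)) XE] := eE M TM X.
  + move=> n; exists [set fun _ : 'I_1 => y l m | m in `I_n.+1] => //.
    exact: finite_image.
  + by move=> a Xa _ [m mn <-]; apply: Xa; exists m => //; apply: ltnW.
  have : X m (fun=> x l m.+1).
    by move=> _ [m' m'm <-] /=; apply/pE => //; rewrite neq_ltn m'm orbT.
  rewrite -XE => /(_ (fun=> y l m.+1)) H; apply/npe/pSE/H.
  by exists m.+1 => /=.
- by have [v vi] := pM i; have [w wj] := pM j; rewrite -vi -wj.
- by have [v vi] := pM i; have [w wj] := pM j; rewrite -vi -wj /= vi wj IH.
- by have [v vi] := pM i; have [w wj] := pM j; rewrite -vi -wj /= !vi !wj IH IH'.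
- by have [v vi] := pM i; have [w wj] := pM j; rewrite -vi -wj /= !vi !wj IH IH'.
Qed.

Lemma cps_symbol_code k : exists c : symbol (cps_sig k) -> nat, injective c.
Proof.
exists (fun r => pickle (match r with
  | Geo (Level l) => (0, val l) | Geo Edge => (1, 0)
  | Colour i => (2, val i) | Incidence i => (3, val i) end)).
move=> [[l|]|i|i] [[l'|]|i'|i'] /(pcan_inj pickleK) //.
- by case=> /val_inj->.
- by case=> /val_inj->.
- by case=> /val_inj->.
Qed.

(** * The geometry of the free pseudospace *)

Local Notation pt := point_level.
Local Notation ln := line_level.
Local Notation pl := plane_level.

Lemma level_ind (P : 'I_3 -> Prop) : P pt -> P ln -> P pl -> forall l, P l.
Proof.
move=> P0 P1 P2 [[|[|[|//]]] l3].
- by rewrite (_ : Ordinal l3 = pt) //; apply: val_inj.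
- by rewrite (_ : Ordinal l3 = ln) //; apply: val_inj.
- by rewrite (_ : Ordinal l3 = pl) //; apply: val_inj.
Qed.

Lemma consecutive_sym l l' : consecutive l l' = consecutive l' l.
Proof. by rewrite /consecutive orbC. Qed.

Lemma adjacentC u v : adjacent u v <-> adjacent v u.
Proof. by split; apply: adj_sym. Qed.

Lemma new_flag_in j a b c (lo hi l : 'I_3) :
  lo <= l <= hi -> new_flag j a b c lo hi l = New j a b c lo hi l.
Proof. by rewrite /new_flag => ->. Qed.

Lemma adjacent_new j a b c (lo hi l l' : 'I_3) :
  lo <= l <= hi -> consecutive l l' ->
  adjacent (new_flag j a b c lo hi l) (new_flag j a b c lo hi l').
Proof. by move=> lP ll'; rewrite (new_flag_in _ _ _ _ lP); apply: adj_new. Qed.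

(** The generating edges of [adjacent], before closing under symmetry; case analysis on them does
    not run into the symmetry rule. *)
Inductive attached : vertex -> vertex -> Prop :=
| attached_start l l' : consecutive l l' -> attached (Start l) (Start l')
| attached_new j a b c (lo hi l l' : 'I_3) : lo <= l <= hi -> consecutive l l' ->
    attached (New j a b c lo hi l) (new_flag j a b c lo hi l').

Lemma adjacentP u v : adjacent u v <-> attached u v \/ attached v u.
Proof.
split=> [|[[]|[]]]; last by move=> *; apply/adj_sym/adj_new.
- elim=> {u v} [l l' ll'|j a b c lo hi l l' lP ll'|u u' _].
  + by left; apply: attached_start.
  + by left; apply: attached_new.
  + by case; [right|left].
- exact: adj_start.
- exact: adj_new.
- by move=> l l' ll'; apply/adj_sym/adj_start.
Qed.

Lemma level_new_flag j a b c lo hi l :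
  flag a b c -> level (new_flag j a b c lo hi l) = l.
Proof.
case=> aP bP cP _ _; rewrite /new_flag; case: ifP => // _.
by elim/level_ind: l.
Qed.

Lemma adjacent_level u v :
  built u -> built v -> adjacent u v -> consecutive (level u) (level v).
Proof.
wlog: u v / attached u v.
  move=> H bu bv uv; have /adjacentP[/H|/H] := uv; first exact.
  by rewrite consecutive_sym; apply=> //; apply/adj_sym.
case=> [//|j a b c lo hi l l' lP ll' bu _ _].
by inversion bu; rewrite level_new_flag.
Qed.

Lemma flag_new_flag j a b c (lo hi : 'I_3) : flag a b c ->
  flag (new_flag j a b c lo hi pl) (new_flag j a b c lo hi ln)
       (new_flag j a b c lo hi pt).
Proof.
move=> F; have [_ _ _ ab bc] := F; split; rewrite ?level_new_flag //.
- have [plP|plN] := boolP (lo <= pl <= hi); first exact: adjacent_new.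
  have [lnP|lnN] := boolP (lo <= ln <= hi); first exact/adj_sym/adjacent_new.
  by rewrite /new_flag (negbTE plN) (negbTE lnN).
- have [lnP|lnN] := boolP (lo <= ln <= hi); first exact: adjacent_new.
  have [ptP|ptN] := boolP (lo <= pt <= hi); first exact/adj_sym/adjacent_new.
  by rewrite /new_flag (negbTE ptN) (negbTE lnN).
Qed.

Definition built_flag a b c := [/\ built a, built b, built c & flag a b c].

Lemma built_new_flag j a b c (lo hi l : 'I_3) :
  built_flag a b c -> built (new_flag j a b c lo hi l).
Proof.
move=> [ba bb bc F]; rewrite /new_flag; case: ifP => [lP|_].
  exact: built_new.
by case: ifP => // _; case: ifP.
Qed.

Lemma built_flag_start : built_flag (Start pl) (Start ln) (Start pt).
Proof. by split; try exact: built_start; split=> //; apply: adj_start. Qed.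

Lemma built_flag_new_flag j a b c (lo hi : 'I_3) : built_flag a b c ->
  built_flag (new_flag j a b c lo hi pl) (new_flag j a b c lo hi ln)
             (new_flag j a b c lo hi pt).
Proof.
by move=> F; have [_ _ _ F'] := F; split; try exact: built_new_flag;
   apply: flag_new_flag.
Qed.

Definition flag_vertex (a b c : vertex) (l : 'I_3) :=
  if l == pl then a else if l == ln then b else c.

(** A vertex is created within a flag: the initial one or the one produced by the operation that
    adds it. Operations act on flags, so realising something over a single vertex starts by choosing
    such a flag. *)
Lemma in_flag v : built v ->
  exists a b c, built_flag a b c /\ v = flag_vertex a b c (level v).
Proof.
case=> [l|j a b c lo hi l ba bb bc F lP].
  exists (Start pl), (Start ln), (Start pt); split; first exact: built_flag_start.
  by elim/level_ind: l.
exists (new_flag j a b c lo hi pl), (new_flag j a b c lo hi ln),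
  (new_flag j a b c lo hi pt); split; first exact: built_flag_new_flag.
rewrite -(new_flag_in j a b c lP) level_new_flag //.
by move: lP; elim/level_ind: l.
Qed.

(* The exceptional point of the line [b] in the planes which are not added over
   [b].  A line added with an odd index by the letter [{1}] to a flag [a - b - c]
   gets a later point as its exceptional point in [a], so that [c] is ordinary. *)
Definition line_expt (b : vertex) : vertex :=
  match b with
  | Start _ => Start pt
  | New j a1 b1 c1 lo hi _ =>
      if [&& lo == ln, hi == ln & odd j] then New 0 a1 b c1 pt pt pt
      else new_flag j a1 b1 c1 lo hi pt
  end.

(** The first case is a plane added over the existing line [b] by the letter {2}: the point of the
    flag becomes exceptional. Thus every point of a line is exceptional in infinitely many
    planes. *)
Definition expt (a b : vertex) : vertex :=
  match a with
  | New _ _ b1 c1 lo _ _ =>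
      if (lo == pl) && `[< b1 = b >] then c1 else line_expt b
  | _ => line_expt b
  end.

Lemma exptP a b : built a -> built b -> level a = pl -> level b = ln ->
  [/\ built (expt a b), level (expt a b) = pt & adjacent b (expt a b)].
Proof.
move=> ba bb aP bP.
have: [/\ built (line_expt b), level (line_expt b) = pt & adjacent b (line_expt b)].
  case: bb bP => [l /= ->|j a1 b1 c1 lo hi l ba1 bb1 bc1 F lP /= lE].
    by split; [apply: built_start| |apply: adj_start].
  rewrite {}lE in lP *; case: ifP => [/and3P[/eqP ? /eqP ? jodd]|_].
    (* Here the exceptional point is the one added by the letter {0} with index 0 to the flag formed
       by [a1], the new line and [c1]. *)
    subst; have F' := built_flag_new_flag j ln ln (And4 ba1 bb1 bc1 F).
    rewrite /new_flag /= in F'; have [_ b1' _ [_ _ _ F1 F2]] := F'.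
    split=> //; first by apply: built_new => //; split=> //; case: F.
    by apply: adj_sym; apply: (@adj_new 0 a1 _ c1 pt pt pt ln).
  have := built_flag_new_flag j lo hi (And4 ba1 bb1 bc1 F).
  by rewrite (new_flag_in _ _ _ _ lP) => -[_ _ ? [_ _ ? _ ?]].
case: ba aP => [l //|j a1 b1 c1 lo hi l ba1 bb1 bc1 F lP /= lE].
case: ifP => // /andP[_ /asboolP<-] _.
by case: F => *; split.
Qed.

(* [closed_bounded] provides infinitely many unused names over every flag. *)
Record closed (Z : set vertex) : Prop := Closed {
  closed_built : Z `<=` built;
  closed_start : forall l, Z (Start l);
  closed_parents : forall j a b c lo hi l,
    Z (New j a b c lo hi l) -> [/\ Z a, Z b & Z c];
  closed_twin : forall j a b c (lo hi l l' : 'I_3),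
    Z (New j a b c lo hi l) -> lo <= l' <= hi -> Z (New j a b c lo hi l');
  closed_line_expt : forall j a b c, odd j -> Z (New j a b c ln ln ln) ->
    Z (New 0 a (New j a b c ln ln ln) c pt pt pt);
  closed_bounded : exists N, forall j a b c lo hi l,
    Z (New j a b c lo hi l) -> j < N }.

Lemma closed_new_flag Z j a b c lo hi l l' : closed Z ->
  Z (New j a b c lo hi l) -> Z (new_flag j a b c lo hi l').
Proof.
move=> ZC Zl; rewrite /new_flag; case: ifP => [|_].
  exact: closed_twin Zl.
by have [? ? ?] := closed_parents ZC Zl; case: ifP => // _; case: ifP.
Qed.

Lemma closed_expt Z a b : closed Z -> Z a -> Z b -> level b = ln -> Z (expt a b).
Proof.
move=> ZC Za Zb bP.
have: Z (line_expt b).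
  case: b Zb bP => [l|j a1 b1 c1 lo hi l] Zb /= bP; first exact: closed_start.
  case: ifP => [/and3P[/eqP ? /eqP ? jodd]|_]; last exact: closed_new_flag Zb.
  by subst; apply: closed_line_expt.
case: a Za => [//|j a1 b1 c1 lo hi l] Za /=.
by case: ifP => // _ _; have [] := closed_parents ZC Za.
Qed.

(** Of two adjacent vertices one is attached to the other. If [x] were attached to the new vertex,
    the parents or twins of [x] would put the latter into [Z]. So the new vertex is attached to [x],
    which is an old vertex of the flag because a twin would again put the new vertex into [Z]. *)
Lemma closed_neighbour Z j a b c (lo hi l : 'I_3) x :
  closed Z -> lo <= l <= hi -> ~ Z (New j a b c lo hi l) -> Z x ->
  adjacent x (New j a b c lo hi l) ->
  exists l', [/\ consecutive l l', ~~ (lo <= l' <= hi) &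
                 x = new_flag j a b c lo hi l'].
Proof.
move=> ZC lP; set w := New _ _ _ _ _ _ _ => nZw Zx /adjacentP[xw|wx].
  move eq_w: w xw => w' xw; case: xw eq_w Zx => [//|j' a' b' c' lo' hi' l1 l1' _ _ wE].
    by move=> /(closed_new_flag l1' ZC); rewrite -wE.
move eq_w: w wx => w' wx; case: wx eq_w Zx => [//|j' a' b' c' lo' hi' l1 l1' _ ll'].
rewrite /w => -[? ? ? ? ? ? ?] Zx; subst; exists l1'; split=> //.
apply/negP => l1P; apply: nZw; move: Zx; rewrite new_flag_in // => Zx.
exact: closed_twin Zx _.
Qed.

(** A line added by the letter {1} with an odd index takes along the point that [line_expt] declares
    exceptional on it; without this point the enlarged set would not be closed. *)
Definition block j a b c (lo hi : 'I_3) : set vertex :=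
  [set v | (exists2 l : 'I_3, lo <= l <= hi & v = New j a b c lo hi l) \/
     [/\ lo = ln, hi = ln, odd j &
        v = New 0 a (New j a b c ln ln ln) c pt pt pt]].

Lemma blockE j a b c (lo hi : 'I_3) (U : set vertex) :
  U `<=` block j a b c lo hi ->
  (forall l : 'I_3, lo <= l <= hi -> U (New j a b c lo hi l)) ->
  ([/\ lo = ln, hi = ln & odd j] ->
    U (New 0 a (New j a b c ln ln ln) c pt pt pt)) ->
  block j a b c lo hi = U.
Proof.
move=> UB BU BU'; apply/seteqP; split=> // v [[l lP ->]|[? ? ? ->]].
  exact: BU.
exact: BU'.
Qed.

Lemma block_point j a b c : block j a b c pt pt = [set New j a b c pt pt pt].
Proof.
apply: blockE => [v ->|l|[]//]; first by left; exists pt.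
by elim/level_ind: l.
Qed.

Lemma block_plane j a b c : block j a b c pl pl = [set New j a b c pl pl pl].
Proof.
apply: blockE => [v ->|l|[]//]; first by left; exists pl.
by elim/level_ind: l.
Qed.

Lemma block_line j a b c (u := New j a b c ln ln ln) :
  block j a b c ln ln =
  if odd j then [set u; New 0 a u c pt pt pt] else [set u].
Proof.
case: (boolP (odd j)) => jodd; apply: blockE.
- by move=> v [|] ->; [left; exists ln|right; split].
- by elim/level_ind => // _; left.
- by right.
- by move=> v ->; left; exists ln.
- by elim/level_ind.
- by case=> _ _; rewrite (negbTE jodd).
Qed.

Lemma block_line_point j a b c :
  block j a b c pt ln = [set New j a b c pt ln ln; New j a b c pt ln pt].
Proof.
apply: blockE => [v|l|[]//].
  by case=> ->; left; [exists ln|exists pt].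
by elim/level_ind: l => // _; [right|left].
Qed.

Lemma block_plane_line j a b c :
  block j a b c ln pl = [set New j a b c ln pl ln; New j a b c ln pl pl].
Proof.
apply: blockE => [v|l|[]//].
  by case=> ->; left; [exists ln|exists pl].
by elim/level_ind: l => // _; [left|right].
Qed.

Lemma block_flag j a b c : block j a b c pt pl =
  [set New j a b c pt pl ln; New j a b c pt pl pt; New j a b c pt pl pl].
Proof.
apply: blockE => [v|l|[]//].
  by case=> [[|]|] ->; left; [exists ln|exists pt|exists pl].
by elim/level_ind: l => // _; [left; right|left; left|right].
Qed.

Lemma closed_block Z j a b c (lo hi : 'I_3) :
  closed Z -> Z a -> Z b -> Z c -> flag a b c ->
  closed (Z `|` block j a b c lo hi).
Proof.
move=> ZC Za Zb Zc F.
have BF : built_flag a b c by split=> //; apply: (closed_built ZC).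
have [_ b1 _ F1] := built_flag_new_flag j ln ln BF.
rewrite /new_flag /= in b1 F1.
split.
- move=> v [/(closed_built ZC)//|[[l lP ->]|[_ _ jodd ->]]].
    by apply: built_new => //; apply: (closed_built ZC).
  by apply: built_new => //; apply: (closed_built ZC).
- by move=> l; left; apply: closed_start.
- move=> j' a' b' c' lo' hi' l' [/(closed_parents ZC)[? ? ?]|].
    by split; left.
  case=> [[l lP [? ? ? ? ? ? ?]]|[? ? jodd [? ? ? ? ? ? ?]]]; subst.
    by split; left.
  split; [by left| |by left].
  by right; left; exists ln.
- move=> j' a' b' c' lo' hi' l l' [Zl lP|]; first by left; apply: closed_twin Zl lP.
  case=> [[l1 l1P [? ? ? ? ? ? ?]] lP|[? ? jodd [? ? ? ? ? ? ?]] lP]; subst.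
    by right; left; exists l'.
  right; right; split=> //; congr New.
  by move: lP; elim/level_ind: l'.
- move=> j' a' b' c' jodd [|]; first by left; apply: closed_line_expt.
  case=> [[l1 l1P [? ? ? ? ? ? ?]]|[? ? _ [? ? ? ? ? ? ?]]] //; subst.
  by right; right.
- have [N NP] := closed_bounded ZC.
  exists (maxn N j.+1) => j' a' b' c' lo' hi' l' [/NP jN|].
    by rewrite leq_max jN.
  case=> [[l1 l1P [-> _ _ _ _ _ _]]|[_ _ _ [-> _ _ _ _ _ _]]].
    by rewrite leq_max ltnSn orbT.
  by rewrite leq_max orbT.
Qed.

Definition fresh (X : set vertex) (l : 'I_3) (P : set vertex) (u : vertex) :=
  [/\ level u = l, ~ X u & forall x, X x -> (adjacent x u <-> P x)].

Lemma fresh_sub X Y l P u : X `<=` Y -> fresh Y l P u -> fresh X l P u.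
Proof. by move=> XY [ul uY uP]; split=> // [/XY //|x /XY/uP]. Qed.

(** * Colours and free extensions *)

Section Colour.
Variables (k : nat) (k_gt0 : 0 < k).

(** For a line of colour [i], this is the index which the axioms force on the pair (a, c): the
    exceptional point is one step ahead. *)
Definition shift (a b c : vertex) (i : 'I_k) : 'I_k :=
  if `[< expt a b = c >] then ordS i else i.

(** A line added by {1} to a flag must give [c] the index it already has in [a]. If [j] is odd, [c]
    is ordinary on the new line and the colour equals this index; if [j] is even, [c] is exceptional
    and the colour is one less. The other letters that add a line leave its colour free, and it runs
    through all residues mod [k]. *)
Fixpoint colour (v : vertex) : 'I_k :=
  match v with
  | Start _ => Ordinal k_gt0
  | New j a b c lo hi _ =>
      if (lo == ln) && (hi == ln) then
        let i := shift a b c (colour b) in if odd j then i else ord_pred i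
      else Ordinal (ltn_pmod j k_gt0)
  end.

(* The index [i] such that [I_i(a, c)], computed on the line [b]. *)
Definition label (a b c : vertex) : 'I_k := shift a b c (colour b).

(** A step may join a plane and a point of [X] by a new line only if a line of [X] already joins
    them and gives the same index. Hence steps never alter the incidences between vertices already
    present. *)
Definition anchored (X : set vertex) a u c :=
  exists b, [/\ X a, X b, X c, flag a b c & label a b c = label a u c].

(* [step X U]: the vertices of [U] are freely added to [X], with their
   exceptional points in [X] or [U]. *)
Inductive step (X : set vertex) : set vertex -> Prop :=
| step_point b u : X b -> level b = ln -> fresh X pt [set b] u ->
    (forall a, X a -> level a = pl -> adjacent a b -> expt a b <> u) ->
    step X [set u]
| step_plane b u : X b -> level b = ln -> fresh X pl [set b] u ->
    X (expt u b) -> step X [set u]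
| step_line_between a c u : fresh X ln [set a; c] u -> expt a u = c ->
    anchored X a u c -> step X [set u]
| step_line_point_between a c u w : fresh X ln [set a; c] u ->
    fresh (X `|` [set u]) pt [set u] w -> expt a u = w ->
    anchored X a u c -> step X [set u; w]
| step_line_point a u w : X a -> level a = pl -> fresh X ln [set a] u ->
    fresh (X `|` [set u]) pt [set u] w -> expt a u = w -> step X [set u; w]
| step_line_through c u : X c -> level c = pt -> fresh X ln [set c] u ->
    step X [set u]
| step_line u : fresh X ln set0 u -> step X [set u].

(** * Sequences of steps and their commutation *)

Inductive ext (X : set vertex) : set vertex -> Prop :=
| ext_refl : ext X X
| ext_step U Y : step X U -> ext (X `|` U) Y -> ext X Y.

Lemma ext_sub X Y : ext X Y -> X `<=` Y.
Proof.
elim=> [{}X x //|{}X U {}Y _ _ XUY x Xx].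
by apply: XUY; left.
Qed.

Lemma ext_trans X Y Z : ext X Y -> ext Y Z -> ext X Z.
Proof. by elim=> [//|{}X U {}Y XU _ IH /IH]; apply: ext_step. Qed.

Lemma ext1 X U : step X U -> ext X (X `|` U).
Proof. by move=> XU; apply: ext_step XU (ext_refl _). Qed.

(** [W] is attached to [Y] only along [X], also as far as exceptional points in planes of [W] are
    concerned. Under this condition the steps from [X] to [Y] can be performed after adding [W]. *)
Definition free_over (X Y W : set vertex) :=
  [/\ forall w, W w -> ~ Y w,
      forall w y, W w -> Y y -> adjacent y w -> X y
    & forall a b, W a -> Y b -> level a = pl -> adjacent b a -> X (expt a b)].

Lemma fresh_free X W U l P u : (forall w, W w -> ~ (X `|` U) w) -> U u ->
  P `<=` X -> ~ X u -> (forall w, W w -> adjacent u w -> X u) ->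
  fresh X l P u -> fresh (X `|` W) l P u.
Proof.
move=> WY Uu PX nXu nuw [ul uX uP]; split=> //.
  by move=> [//|Wu]; apply: (WY _ Wu); right.
move=> x [/uP//|Wx]; split=> [/adjacentC/(nuw _ Wx)//|/PX Xx].
by case: (WY _ Wx); left.
Qed.

Lemma step_free X U W : step X U -> free_over X (X `|` U) W -> step (X `|` W) U.
Proof.
move=> XU [dis adj ex].
have Fr u l P : U u -> P `<=` X -> fresh X l P u -> fresh (X `|` W) l P u.
  move=> Uu PX uF; apply: (@fresh_free X W U) => //; first by case: uF.
  by move=> w Ww; apply: adj => //; right.
have Fr2 u w : U u -> U w -> ~ X w -> fresh (X `|` [set u]) pt [set u] w ->
    fresh (X `|` W `|` [set u]) pt [set u] w.
  move=> Uu Uw nXw wF; rewrite setUAC; apply: (@fresh_free _ _ U) => //.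
  - by move=> x Wx [[Xx|xu]|Ux]; apply: (dis x Wx); [left|right; rewrite xu|right].
  - by case: wF.
  - by move=> x Wx wx; case: nXw; apply: adj wx => //; right.
have An a u c : anchored X a u c -> anchored (X `|` W) a u c.
  by move=> [b [Xa Xb Xc F e]]; exists b; split=> //; left.
have set2 a u c : anchored X a u c -> [set a; c] `<=` X.
  by move=> [b [Xa Xb Xc _ _]] x [->|->].
case: XU dis adj ex Fr Fr2 => [b u Xb bP uF ub|b u Xb bP uF ub|a c u uF auc XA
  |a c u w uF wF auc XA|a u w Xa aP uF wF auw|c u Xc cP uF|u uF] dis adj ex Fr Fr2.
- apply: (@step_point _ b) => //; first by left.
    by apply: Fr => // x ->.
  move=> a [Xa|Wa] aP ab; first exact: ub.
  (* Were [u] exceptional in a plane of [W], it would belong to [X] by the last clause of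
     [free_over]. *)
  move=> eu; case: uF => _ + _; apply; rewrite -eu; apply: ex => //; first by left.
  exact/adj_sym.
- apply: (@step_plane _ b) => //; [by left| |by left].
  by apply: Fr => // x ->.
- by apply: (@step_line_between _ a c) => //; [apply: Fr => //; apply: set2 XA|apply: An].
- apply: (@step_line_point_between _ a c) => //; [apply: Fr| |exact: An] => //.
  + by left.
  + exact: set2 XA.
  + apply: Fr2 => //; [by left|by right|].
    by case: wF => _ nw _ Xw; apply: nw; left.
- apply: (@step_line_point _ a) => //; [by left|apply: Fr|] => //.
  + by left.
  + by move=> x ->.
  + apply: Fr2 => //; [by left|by right|].
    by case: wF => _ nw _ Xw; apply: nw; left.
- by apply: (@step_line_through _ c) => //; [by left|apply: Fr => // x ->].
- by apply: step_line; apply: Fr.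
Qed.

Lemma free_over_sub X X' Y Y' W : X `<=` X' -> Y `<=` Y' ->
  free_over X Y' W -> free_over X' Y W.
Proof.
move=> XX' YY' [dis adj ex]; split.
- by move=> w /dis nY /YY'.
- by move=> w y Ww /YY' Yy wy; apply/XX'/(adj w).
- by move=> a b Wa /YY' Yb aP ab; apply/XX'/ex.
Qed.

Lemma ext_free X Y W : ext X Y -> free_over X Y W -> ext (X `|` W) (Y `|` W).
Proof.
elim=> {X Y} [X _|X U Y XU UY IH F]; first exact: ext_refl.
apply: (@ext_step _ U).
  apply: step_free XU _; apply: free_over_sub F => //; exact: ext_sub.
rewrite setUAC; apply: IH; apply: free_over_sub F; last by [].
by move=> x Xx; left.
Qed.

(** Reaching a closed set stands for reaching the whole pseudospace, since a closed set can be
    extended by steps to contain any given vertex, see [grow]. *)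
Definition strong X := exists2 Z, closed Z & ext X Z.

Lemma fresh_on Z l u w : level w = l -> ~ Z w -> w <> u -> adjacent u w ->
  (forall x, Z x -> ~ adjacent x w) -> fresh (Z `|` [set u]) l [set u] w.
Proof.
move=> wl Zw wu uw nZ; split=> //; first by case.
move=> x [Zx|->]; last by split.
by split=> [/(nZ _ Zx)//|xu]; rewrite xu.
Qed.

Lemma expt_old Z a u : closed Z -> Z a -> ~ Z u -> expt a u = line_expt u.
Proof.
move=> ZC Za nZu; case: a Za => [//|j' a' b' c' lo' hi' l'] Za /=.
case: ifP => // /andP[_ /asboolP bu]; case: nZu; rewrite -bu.
by have [] := closed_parents ZC Za.
Qed.

(** * The letters as sequences of steps *)

Section Letters.
Variables (Z : set vertex) (j : nat) (a b c : vertex) (lo hi : 'I_3).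
Hypotheses (ZC : closed Z) (Za : Z a) (Zb : Z b) (Zc : Z c) (F : flag a b c).
Hypothesis new : forall l : 'I_3, lo <= l <= hi -> ~ Z (New j a b c lo hi l).

Lemma fresh_new (l : 'I_3) (P : set vertex) : lo <= l <= hi ->
  (forall l', consecutive l l' -> ~~ (lo <= l' <= hi) ->
     P (flag_vertex a b c l')) ->
  (forall x, P x -> adjacent x (New j a b c lo hi l)) ->
  fresh Z l P (New j a b c lo hi l).
Proof.
move=> lP outP Padj; split=> //; first exact: new.
move=> x Zx; split=> [xw|/Padj//].
have [l' [ll' l'N ->]] := closed_neighbour ZC lP (new lP) Zx xw.
by rewrite /new_flag (negbTE l'N); apply: outP.
Qed.

Lemma isolated_new (l : 'I_3) : lo <= l <= hi ->
  (forall l', consecutive l l' -> lo <= l' <= hi) ->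
  forall x, Z x -> ~ adjacent x (New j a b c lo hi l).
Proof.
move=> lP inP x Zx xw.
by have [l' [/inP-> //]] := closed_neighbour ZC lP (new lP) Zx xw.
Qed.

End Letters.

Definition unused (Z : set vertex) j a b c (lo hi : 'I_3) :=
  forall l : 'I_3, lo <= l <= hi -> ~ Z (New j a b c lo hi l).

Section LetterCases.
Variables (Z : set vertex) (j : nat) (a b c : vertex).
Hypotheses (ZC : closed Z) (Za : Z a) (Zb : Z b) (Zc : Z c) (F : flag a b c).

Lemma letter_point (u := New j a b c pt pt pt) : unused Z j a b c pt pt ->
  fresh Z pt [set b] u /\
  (forall a', Z a' -> level a' = pl -> adjacent a' b -> expt a' b <> u).
Proof.
move=> nu; split; last first.
  move=> a' Za' _ _ eu; apply: (nu pt) => //; rewrite -/u -eu.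
  by apply: closed_expt => //; case: F.
apply: fresh_new => //; first by elim/level_ind.
by move=> _ ->; apply: adj_sym; apply: (@adj_new j a b c pt pt pt ln).
Qed.

Lemma letter_plane (u := New j a b c pl pl pl) : unused Z j a b c pl pl ->
  fresh Z pl [set b] u /\ expt u b = c.
Proof.
move=> nu; split; last by rewrite /= asboolT.
apply: fresh_new => //; first by elim/level_ind.
by move=> _ ->; apply: adj_sym; apply: (@adj_new j a b c pl pl pl ln).
Qed.

Lemma letter_line (u := New j a b c ln ln ln) (w := New 0 a u c pt pt pt) :
  unused Z j a b c ln ln ->
  [/\ fresh Z ln [set a; c] u, label a b c = label a u c,
      expt a u = (if odd j then w else c)
    & fresh (Z `|` [set u]) pt [set u] w].
Proof.
move=> nu; have nZu : ~ Z u by exact: nu.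
have nZw : ~ Z w by case/(closed_parents ZC).
have eu : expt a u = if odd j then w else c by rewrite (expt_old ZC Za nZu).
have cu : colour u = if odd j then label a b c else ord_pred (label a b c) by [].
split=> //.
- apply: fresh_new => //; first by elim/level_ind => // _ _; [right|left].
  by move=> _ [->|->]; apply: adj_sym;
    [apply: (@adj_new j a b c ln ln ln pl)|apply: (@adj_new j a b c ln ln ln pt)].
- rewrite [RHS]/label /shift eu cu; case: (odd j).
    by rewrite asboolF // => wc; apply: nZw; rewrite wc.
  by rewrite asboolT // ord_predK.
- apply: fresh_on => //.
    by apply: adj_sym; apply: (@adj_new 0 a u c pt pt pt ln).
  move=> x Zx /(closed_neighbour ZC _ nZw Zx)[] //.
  by elim/level_ind => -[] // _ _ xu; apply: nZu; rewrite xu in Zx.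
Qed.

Lemma letter_line_point (u := New j a b c pt ln ln) (w := New j a b c pt ln pt) :
  unused Z j a b c pt ln -> [/\ fresh Z ln [set a] u, fresh (Z `|` [set u]) pt [set u] w,
    expt a u = w & colour u = Ordinal (ltn_pmod j k_gt0)].
Proof.
move=> nu; split=> //.
- apply: fresh_new => //; first by elim/level_ind.
  by move=> _ ->; apply: adj_sym; apply: (@adj_new j a b c pt ln ln pl).
- apply: fresh_on => //; [exact: nu| |].
    by apply: (@adj_new j a b c pt ln ln pt).
  by apply: isolated_new => //; elim/level_ind.
- by rewrite (@expt_old Z) //; apply: nu.
Qed.

Lemma letter_plane_line (u := New j a b c ln pl ln) (w := New j a b c ln pl pl) :
  unused Z j a b c ln pl -> [/\ fresh Z ln [set c] u, fresh (Z `|` [set u]) pl [set u] w,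
    expt w u = c & colour u = Ordinal (ltn_pmod j k_gt0)].
Proof.
move=> nu; split=> //.
- apply: fresh_new => //; first by elim/level_ind.
  by move=> _ ->; apply: adj_sym; apply: (@adj_new j a b c ln pl ln pt).
- apply: fresh_on => //; [exact: nu| |].
    by apply: (@adj_new j a b c ln pl ln pl).
  by apply: isolated_new => //; elim/level_ind.
Qed.

Lemma letter_flag (u := New j a b c pt pl ln) (w := New j a b c pt pl pt)
    (v := New j a b c pt pl pl) :
  unused Z j a b c pt pl -> [/\ fresh Z ln set0 u, fresh (Z `|` [set u]) pt [set u] w,
    fresh (Z `|` [set u] `|` [set w]) pl [set u] v,
    expt v u = w & colour u = Ordinal (ltn_pmod j k_gt0)].
Proof.
move=> nu; split=> //.
- by apply: fresh_new => //; elim/level_ind.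
- apply: fresh_on => //; [exact: nu| |].
    by apply: (@adj_new j a b c pt pl ln pt).
  by apply: isolated_new => //; elim/level_ind.
- rewrite setUAC; apply: fresh_on => //.
  + by case=> //; apply: nu.
  + by apply: (@adj_new j a b c pt pl ln pl).
  + move=> x [|->]; first by apply: isolated_new => //; elim/level_ind.
    have bu (l : 'I_3) : built (New j a b c pt pl l).
      apply: built_new => //; try exact: (closed_built ZC).
      by elim/level_ind: l.
    by move/(adjacent_level (bu _) (bu _)).
Qed.

Lemma ext_letter_flag : unused Z j a b c pt pl ->
  ext (Z `|` [set New j a b c pt pl ln]) (Z `|` block j a b c pt pl).
Proof.
move=> nu; have [uF wF vF ve _] := letter_flag nu; rewrite block_flag !setUA.
(* The point precedes the plane, because [step_plane] requires the exceptional point to be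
   present. *)
apply: (ext_step (U := [set New j a b c pt pl pt])).
  apply: (@step_point _ (New j a b c pt pl ln)) => //; first by right.
  move=> a' [Za'|->//] _ a'u.
  by case: uF => _ _ /(_ _ Za')/iffLR/(_ a'u).
apply: ext1; apply: (@step_plane _ (New j a b c pt pl ln)) => //; first by left; right.
by rewrite ve; right.
Qed.

(** The letters {0}, {1}, {2} and {0,1} are single steps. For {1,2} and {0,1,2} the line comes first
    and the other vertices are attached to it. *)
Lemma ext_block (lo hi : 'I_3) : lo <= hi -> unused Z j a b c lo hi ->
  ext Z (Z `|` block j a b c lo hi).
Proof.
move=> lohi nu; have [aP bP cP ab bc] := F.
move: lo hi lohi nu; apply: level_ind; apply: level_ind => // _ nu.
- have [uF ue] := letter_point nu.
  rewrite block_point; exact: ext1 (step_point Zb bP uF ue).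
- have [uF wF ue _] := letter_line_point nu.
  rewrite block_line_point; exact: ext1 (step_line_point Za aP uF wF ue).
- have [uF _ _ _ _] := letter_flag nu.
  exact: ext_step (step_line uF) (ext_letter_flag nu).
- have [uF ul ue wF] := letter_line nu.
  have An : anchored Z a (New j a b c ln ln ln) c by exists b.
  rewrite block_line; case: ifP ue => jodd ue.
    exact: ext1 (step_line_point_between uF wF ue An).
  exact: ext1 (step_line_between uF ue An).
- have [uF wF we _] := letter_plane_line nu.
  rewrite block_plane_line; apply: ext_step (step_line_through Zc cP uF) _; rewrite setUA.
  apply: ext1; apply: (@step_plane _ (New j a b c ln pl ln)) => //; first by right.
  by rewrite we; left.
- have [uF ue] := letter_plane nu.
  by rewrite block_plane; apply: ext1; apply: (step_plane Zb bP uF); rewrite ue.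
Qed.

End LetterCases.

(** Induction on the name: after the parents, the whole block of the last operation is added at
    once, which preserves closedness. *)
Lemma grow Z v : closed Z -> built v -> exists Z', [/\ closed Z', ext Z Z' & Z' v].
Proof.
move=> ZC bv.
elim: bv Z ZC => {v} [l|j a b c lo hi l ba IHa bb IHb bc IHc F lP] Z ZC.
  by exists Z; split=> //; [apply: ext_refl|apply: closed_start].
have [Za [ZaC ZZa Zaa]] := IHa Z ZC.
have [Zb [ZbC ZZb Zbb]] := IHb Za ZaC.
have [Zc [ZcC ZZc Zcc]] := IHc Zb ZbC.
have ZZ : ext Z Zc by apply: ext_trans ZZa _; apply: ext_trans ZZb _.
have Zca : Zc a by apply/(ext_sub ZZc)/(ext_sub ZZb).
have Zcb : Zc b by apply: (ext_sub ZZc).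
have [Zcv|nZcv] := pselect (Zc (New j a b c lo hi l)); first by exists Zc.
exists (Zc `|` block j a b c lo hi); split; first exact: closed_block.
  apply: ext_trans ZZ _; apply: ext_block => //.
    by case/andP: lP => ll lh; apply: leq_trans lh.
  by move=> l' l'P Zl'; apply: nZcv; apply: closed_twin Zl' lP.
by right; left; exists l.
Qed.

Lemma grow_flag Z a b c : closed Z -> built_flag a b c ->
  exists Z', [/\ closed Z', ext Z Z' & [/\ Z' a, Z' b & Z' c]].
Proof.
move=> ZC [ba bb bc _].
have [Za [ZaC ZZa Zaa]] := grow ZC ba.
have [Zb [ZbC ZZb Zbb]] := grow ZaC bb.
have [Zc [ZcC ZZc Zcc]] := grow ZbC bc.
exists Zc; split=> //; first by apply: ext_trans ZZa _; apply: ext_trans ZZb _.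
by split=> //; [apply/(ext_sub ZZc)/(ext_sub ZZb)|apply: (ext_sub ZZc)].
Qed.

Lemma eventually_unused Z : closed Z ->
  exists N, forall j, N <= j -> forall a b c lo hi, unused Z j a b c lo hi.
Proof.
move=> /closed_bounded[N NP]; exists N => j Nj a b c lo hi l _ /NP.
by rewrite ltnNge Nj.
Qed.

Lemma unused_colour Z (i : 'I_k) : closed Z ->
  exists j, Ordinal (ltn_pmod j k_gt0) = i /\
    forall a b c lo hi, unused Z j a b c lo hi.
Proof.
(* An index which is at least [N] and has residue [i] modulo [k]. *)
move=> /eventually_unused[N NP]; exists (N * k + i); split; last first.
  apply: NP; apply: leq_trans (leq_addr _ _).
  by rewrite -{1}[N]muln1 leq_mul2l k_gt0 orbT.
by apply: val_inj; rewrite /= modnMDl modn_small.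
Qed.

Lemma unused_parity Z p : closed Z ->
  exists j, odd j = p /\ forall a b c lo hi, unused Z j a b c lo hi.
Proof.
move=> /eventually_unused[N NP]; exists (p + N.*2); split.
  by rewrite oddD odd_double addbF; case: p.
by apply: NP; rewrite -addnn addnA leq_addl.
Qed.

Lemma free_over1 X Y l P u : fresh Y l P u -> P `<=` X ->
  (level u = pl -> forall b, Y b -> adjacent b u -> X (expt u b)) ->
  free_over X Y [set u].
Proof.
move=> [ul nYu uP] PX ue; split=> [_ -> //|_ y -> /uP yu /yu/PX //|_ b -> Yb].
by move=> /ue; apply.
Qed.

Lemma free_over2 X Y P u w : fresh Y ln P u -> P `<=` X ->
  fresh (Y `|` [set u]) pt [set u] w -> free_over X Y [set u; w].
Proof.
move=> [ul nYu uP] PX [wl nYw wP]; split.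
- by move=> _ [->|->] // Yw; apply: nYw; left.
- move=> _ y [->|->] Yy; first by move=> /(uP _ Yy)/PX.
  by move=> /(wP _ (or_introl Yy)) yu; case: nYu; rewrite -yu.
- by move=> _ b [->|->] _; rewrite ?ul ?wl.
Qed.

Lemma strong_built X : strong X -> X `<=` built.
Proof. by move=> [Z ZC XZ] x /(ext_sub XZ); apply: closed_built. Qed.

Lemma ext_strong X Y : ext X Y -> strong Y -> strong X.
Proof. by move=> XY [Z ZC YZ]; exists Z => //; apply: ext_trans YZ. Qed.

(** * Realising every kind of step over a strong set *)

Section Realise.
Variable (Y : set vertex).
Hypothesis YS : strong Y.

Lemma strong_grow a b c : built_flag a b c ->
  exists Z, [/\ closed Z, ext Y Z & [/\ Z a, Z b & Z c]].
Proof.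
have [Z ZC YZ] := YS; move=> /(grow_flag ZC)[Z' [ZC' ZZ' H]].
by exists Z'; split=> //; apply: ext_trans YZ _.
Qed.

Lemma realise_point b : Y b -> level b = ln ->
  exists u, [/\ fresh Y pt [set b] u, forall a, Y a -> level a = pl ->
    adjacent a b -> expt a b <> u & strong (Y `|` [set u])].
Proof.
move=> Yb bP; have [a [b' [c [F]]]] := in_flag (strong_built YS Yb).
rewrite bP /flag_vertex /= => bE; subst b'.
have [Z [ZC YZ [Za Zb Zc]]] := strong_grow F; have [_ _ _ F'] := F.
have [N /(_ N (leqnn N) a b c pt pt) nu] := eventually_unused ZC.
have [uF ue] := letter_point ZC Zb F' nu.
exists (New N a b c pt pt pt); split.
- by apply: fresh_sub uF; apply: ext_sub.
- by move=> a' /(ext_sub YZ); apply: ue.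
exists (Z `|` block N a b c pt pt); first exact: closed_block.
rewrite block_point; apply: ext_free => //.
by apply: (free_over1 uF) => // x ->.
Qed.

Lemma realise_plane b c : Y b -> Y c -> level b = ln -> level c = pt ->
  adjacent b c ->
  exists u, [/\ fresh Y pl [set b] u, expt u b = c & strong (Y `|` [set u])].
Proof.
move=> Yb Yc bP cP bc; have [a [b' [c' [F]]]] := in_flag (strong_built YS Yb).
rewrite bP /flag_vertex /= => bE; subst b'.
(* The plane of a flag through [b] also forms a flag with [b] and the prescribed point [c]. *)
have {}F : built_flag a b c.
  case: F => ba bb _ [aP _ _ ab _]; split=> //; exact: (strong_built YS).
have [Z [ZC YZ [Za Zb Zc]]] := strong_grow F; have [_ _ _ F'] := F.
have [N /(_ N (leqnn N) a b c pl pl) nu] := eventually_unused ZC.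
have [uF ue] := letter_plane ZC nu.
exists (New N a b c pl pl pl); split=> //.
  by apply: fresh_sub uF; apply: ext_sub.
exists (Z `|` block N a b c pl pl); first exact: closed_block.
rewrite block_plane; apply: ext_free => //.
apply: (free_over1 uF) => [x ->//|_ b' Zb' b'u].
by case: uF => _ _ /(_ _ Zb')/iffLR/(_ b'u)->; rewrite ue.
Qed.

Lemma built_flag_in a b c : Y a -> Y b -> Y c -> flag a b c -> built_flag a b c.
Proof. by move=> Ya Yb Yc F; split=> //; apply: (strong_built YS). Qed.

Lemma realise_line_between a b c : Y a -> Y b -> Y c -> flag a b c ->
  exists u, [/\ fresh Y ln [set a; c] u, expt a u = c,
    label a b c = label a u c & strong (Y `|` [set u])].
Proof.
move=> Ya Yb Yc F'; have F := built_flag_in Ya Yb Yc F'.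
have [Z [ZC YZ [Za Zb Zc]]] := strong_grow F.
have [N [Nodd /(_ a b c ln ln) nu]] := unused_parity false ZC.
have [uF ul ue _] := letter_line ZC Za Zc nu.
exists (New N a b c ln ln ln); split=> //.
- by apply: fresh_sub uF; apply: ext_sub.
- by rewrite ue Nodd.
exists (Z `|` block N a b c ln ln); first exact: closed_block.
rewrite block_line Nodd; apply: ext_free => //.
by apply: (free_over1 uF) => // x [->|->].
Qed.

Lemma realise_line_point_between a b c : Y a -> Y b -> Y c -> flag a b c ->
  exists u w, [/\ fresh Y ln [set a; c] u,
    fresh (Y `|` [set u]) pt [set u] w, expt a u = w,
    label a b c = label a u c & strong (Y `|` [set u; w])].
Proof.
move=> Ya Yb Yc F'; have F := built_flag_in Ya Yb Yc F'.
have [Z [ZC YZ [Za Zb Zc]]] := strong_grow F.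
have [N [Nodd /(_ a b c ln ln) nu]] := unused_parity true ZC.
have [uF ul ue wF] := letter_line ZC Za Zc nu.
exists (New N a b c ln ln ln), (New 0 a (New N a b c ln ln ln) c pt pt pt).
have YZs := ext_sub YZ.
split=> //; try by rewrite ue Nodd.
- exact: fresh_sub uF.
- by apply: fresh_sub wF; apply: setSU.
exists (Z `|` block N a b c ln ln); first exact: closed_block.
rewrite block_line Nodd; apply: ext_free => //.
by apply: (free_over2 uF _ wF) => // x [->|->].
Qed.

Lemma realise_line_point a i : Y a -> level a = pl ->
  exists u w, [/\ fresh Y ln [set a] u,
    fresh (Y `|` [set u]) pt [set u] w, expt a u = w,
    colour u = i & strong (Y `|` [set u; w])].
Proof.
move=> Ya aP; have [a' [b [c [F]]]] := in_flag (strong_built YS Ya).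
rewrite aP /flag_vertex /= => aE; subst a'.
have [Z [ZC YZ [Za Zb Zc]]] := strong_grow F; have [_ _ _ F'] := F.
have [N [Ni /(_ a b c pt ln) nu]] := unused_colour i ZC.
have [uF wF ue ui] := letter_line_point ZC Za nu.
exists (New N a b c pt ln ln), (New N a b c pt ln pt).
have YZs := ext_sub YZ.
split=> //; try by rewrite ui Ni.
- exact: fresh_sub uF.
- by apply: fresh_sub wF; apply: setSU.
exists (Z `|` block N a b c pt ln); first exact: closed_block.
rewrite block_line_point; apply: ext_free => //.
by apply: (free_over2 uF _ wF) => // x ->.
Qed.

Lemma realise_line_through c i : Y c -> level c = pt ->
  exists u, [/\ fresh Y ln [set c] u, colour u = i & strong (Y `|` [set u])].
Proof.
move=> Yc cP; have [a [b [c' [F]]]] := in_flag (strong_built YS Yc).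
rewrite cP /flag_vertex /= => cE; subst c'.
have [Z [ZC YZ [Za Zb Zc]]] := strong_grow F; have [_ _ _ F'] := F.
have [N [Ni /(_ a b c ln pl) nu]] := unused_colour i ZC.
have [uF wF ue ui] := letter_plane_line ZC nu.
exists (New N a b c ln pl ln).
split=> //; try by rewrite ui Ni.
- by apply: fresh_sub uF; apply: ext_sub.
exists (Z `|` block N a b c ln pl); first exact: closed_block.
rewrite block_plane_line setUA.
(* The letter {1,2} adds a plane as well, which is reached by one more step from [Z] and the
   line. *)
apply: (@ext_trans _ (Z `|` [set New N a b c ln pl ln])).
  by apply: ext_free => //; apply: (free_over1 uF) => // x ->.
apply: ext1; apply: (step_plane _ _ wF) => //; first by right.
by rewrite ue; left.
Qed.

Lemma realise_line i :
  exists u, [/\ fresh Y ln set0 u, colour u = i & strong (Y `|` [set u])].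
Proof.
have [Z [ZC YZ [Za Zb Zc]]] := strong_grow built_flag_start.
have [_ _ _ F'] := built_flag_start.
have [N [Ni /(_ (Start pl) (Start ln) (Start pt) pt pl) nu]] := unused_colour i ZC.
have [uF _ _ _ ui] := letter_flag ZC Za Zb Zc F' nu.
exists (New N (Start pl) (Start ln) (Start pt) pt pl ln).
split=> //; try by rewrite ui Ni.
  by apply: fresh_sub uF; apply: ext_sub.
exists (Z `|` block N (Start pl) (Start ln) (Start pt) pt pl); first exact: closed_block.
apply: ext_trans (ext_letter_flag ZC Za Zb Zc F' nu).
by apply: ext_free => //; apply: (free_over1 uF).
Qed.

End Realise.

(** * Independence of the index of a point in a plane from the line *)

Lemma step_label X U a b c : step X U -> X a -> X c -> (X `|` U) b ->
  flag a b c -> exists b0, [/\ X b0, flag a b0 c & label a b0 c = label a b c].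
Proof.
move=> XU Xa Xc [Xb|Ub] F; first by exists b.
have [aP bP cP ab bc] := F.
have nbr l P u : fresh X l P u -> b = u -> P a /\ P c.
  by move=> [_ _ uP] bu; split; apply/uP => //; rewrite -bu //; apply/adj_sym.
have lev l P u : fresh X l P u -> b = u -> l = ln by case=> <- _ _ bu; rewrite -bu.
(* A new line joining an old plane and an old point was added between them; it is anchored, and its
   anchor is the required line. *)
have anch a0 c0 u : b = u -> fresh X ln [set a0; c0] u -> anchored X a0 u c0 ->
    exists b0, [/\ X b0, flag a b0 c & label a b0 c = label a b c].
  move=> bu uF [b0 [_ Xb0 _ F0 lE]]; have [/= Pa Pc] := nbr _ _ _ uF bu.
  have [aP0 _ cP0 _ _] := F0.
  have aE : a = a0 by case: Pa => // ac; move: aP; rewrite ac cP0.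
  have cE : c = c0 by case: Pc => // ca; move: cP; rewrite ca aP0.
  by exists b0; rewrite aE cE bu.
case: XU Ub.
- by move=> b0 u _ _ uF _ /(lev _ _ _ uF).
- by move=> b0 u _ _ uF _ /(lev _ _ _ uF).
- by move=> a0 c0 u uF _ An bu; apply: anch bu uF An.
- move=> a0 c0 u w uF wF _ An [bu|bw]; first by apply: anch bu uF An.
  by case: wF => + _ _; rewrite -bw bP.
- move=> a0 u w Xa0 a0P uF wF _ [bu|bw].
    by have [_ /= ca] := nbr _ _ _ uF bu; move: cP; rewrite ca a0P.
  by case: wF => + _ _; rewrite -bw bP.
- move=> c0 u Xc0 c0P uF bu.
  by have [/= ac _] := nbr _ _ _ uF bu; move: aP; rewrite ac c0P.
- by move=> u uF bu; have [] := nbr _ _ _ uF bu.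
Qed.

Lemma ext_label X Y a b c : ext X Y -> X a -> X c -> Y b -> flag a b c ->
  exists b0, [/\ X b0, flag a b0 c & label a b0 c = label a b c].
Proof.
elim=> {X Y} [X|X U Y XU _ IH] Xa Xc Yb F; first by exists b.
have [b1 [b1X F1 <-]] := IH (or_introl Xa) (or_introl Xc) Yb F.
exact: step_label XU Xa Xc b1X F1.
Qed.

(** Points and planes are always added as ends of one line, even when this line is itself new. *)
Lemma step_end X U x : step X U -> U x -> level x <> ln -> forall b b',
  (X `|` U) b -> (X `|` U) b' -> level b = ln -> level b' = ln ->
  adjacent b x -> adjacent b' x -> b = b'.
Proof.
move=> XU Ux xP b b' Xb Xb' bP b'P bx b'x.
suff [b0 H] : exists b0, forall b, (X `|` U) b -> level b = ln -> adjacent b x -> b = b0.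
  by rewrite (H b) // -(H b').
case: XU Ux {Xb Xb'}.
- move=> b0 u _ _ [uP _ H] _ /= xu; subst x; exists b0 => d [/H{}H|->]; last by rewrite uP.
  by move=> _ /H.
- move=> b0 u _ _ [uP _ H] _ /= xu; subst x; exists b0 => d [/H{}H|->]; last by rewrite uP.
  by move=> _ /H.
- by move=> a c u [uP _ _] _ _ /= xu; case: xP; rewrite xu.
- move=> a c u w [uP _ _] [wP _ H] _ _ [/= xu|/= xw]; first by case: xP; rewrite xu.
  subst x; exists u => d [Xd|[-> //|->]]; last by rewrite wP.
  by move=> _ /H; apply; left.
- move=> a u w _ _ [uP _ _] [wP _ H] _ [/= xu|/= xw]; first by case: xP; rewrite xu.
  subst x; exists u => d [Xd|[-> //|->]]; last by rewrite wP.
  by move=> _ /H; apply; left.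
- by move=> c u _ _ [uP _ _] /= xu; case: xP; rewrite xu.
- by move=> u [uP _ _] /= xu; case: xP; rewrite xu.
Qed.

Definition coherent (X : set vertex) := forall a b b' c, X a -> X b -> X b' -> X c ->
  flag a b c -> flag a b' c -> label a b c = label a b' c.

(** A new point or plane lies on one line only, and a new line between old vertices repeats the
    index given by an old line. *)
Lemma step_coherent X U : step X U -> coherent X -> coherent (X `|` U).
Proof.
move=> XU coh a b b' c XUa XUb XUb' XUc F F'.
have [aP bP cP ab bc] := F; have [_ bP' _ ab' bc'] := F'.
case: (XUc) => [Xc|Uc]; last first.
  by rewrite (step_end XU Uc _ XUb XUb') // cP.
case: (XUa) => [Xa|Ua]; last first.
  by rewrite (step_end XU Ua _ XUb XUb') // ?aP //; apply: adj_sym.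
have [b0 [Xb0 F0 <-]] := step_label XU Xa Xc XUb F.
have [b0' [Xb0' F0' <-]] := step_label XU Xa Xc XUb' F'.
exact: coh.
Qed.

Lemma ext_coherent X Y : ext X Y -> coherent X -> coherent Y.
Proof. by elim=> [//|{}X U {}Y XU _ IH /(step_coherent XU)]. Qed.

Lemma closed_set_start : closed [set v | exists l, v = Start l].
Proof.
split=> //; try by move=> * [].
- by move=> _ [l ->]; apply: built_start.
- by move=> l; exists l.
- by move=> > [].
- by move=> > [].
- by move=> > _ [].
- by exists 0 => > [].
Qed.

Lemma ext_set_start : ext set0 [set v | exists l, v = Start l].
Proof.
have -> : [set v | exists l, v = Start l] =
    set0 `|` [set Start ln] `|` [set Start pt] `|` [set Start pl].
  apply/seteqP; split=> v; last by case=> [[[//|]|]|] ->; eexists.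
  by case; elim/level_ind=> ->; [left; right|left; left; right|right].
apply: (ext_step (U := [set Start ln])); first by apply: step_line; split.
apply: (ext_step (U := [set Start pt])).
  apply: (@step_point _ (Start ln)) => //; first by right.
    by apply: fresh_on => //; apply: adj_start.
  by move=> a [//|->].
apply: ext1; apply: (@step_plane _ (Start ln)) => //; try by left; right.
  rewrite setUAC; apply: fresh_on => //; first by case=> //.
    exact: adj_start.
  by move=> x [//|->] /(adjacent_level (built_start _) (built_start _)).
by right.
Qed.

Lemma strong0 : strong set0.
Proof.
exists [set v | exists l, v = Start l]; first exact: closed_set_start.
exact: ext_set_start.
Qed.

(** Both flags lie in a closed set reached by steps from the empty set, where coherence is
    trivial. *)
Lemma label_uniq a b b' c : built_flag a b c -> built_flag a b' c ->
  label a b c = label a b' c.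
Proof.
move=> F F'; have [Z [ZC XZ [Za Zb Zc]]] := strong_grow strong0 F.
have [Z' [ZC' ZZ' [Za' Zb' Zc']]] := grow_flag ZC F'.
have coh : coherent Z' by apply: ext_coherent (ext_trans XZ ZZ') _ => ? ? ? ? [].
case: F F' => _ _ _ F [_ _ _ F'].
by apply: coh => //; apply: ext_sub ZZ' _ _.
Qed.

(** * Back and forth *)

(** Exceptional points are compared only when they lie in the domain, and the incidence predicates
    are left out: on strong sets they are recovered from the lines, see [strong_iso_label]. *)
Definition iso (R : vertex -> vertex -> Prop) :=
  [/\ forall x y, R x y -> level x = level y /\ (level x = ln -> colour x = colour y),
      forall x y x' y', R x y -> R x' y' ->
        (x = x' <-> y = y') /\ (adjacent x x' <-> adjacent y y')
    & forall x y x' y' x'' y'', R x y -> R x' y' -> R x'' y'' ->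
        level x = pl -> level x' = ln -> adjacent x x' ->
        (expt x x' = x'' <-> expt y y' = y'')].

Definition source (R : vertex -> vertex -> Prop) := [set x | exists y, R x y].
Definition target (R : vertex -> vertex -> Prop) := [set y | exists x, R x y].

Definition extend (R : vertex -> vertex -> Prop) u u' x y :=
  R x y \/ (x = u /\ y = u').

Lemma source_extend R u u' : source (extend R u u') = source R `|` [set u].
Proof.
apply/seteqP; split=> [x [y [Rxy|[-> _]]]|x [[y Rxy]|->]].
- by left; exists y.
- by right.
- by exists y; left.
- by exists u'; right.
Qed.

Lemma target_extend R u u' : target (extend R u u') = target R `|` [set u'].
Proof.
apply/seteqP; split=> [y [x [Rxy|[_ ->]]]|y [[x Rxy]|->]].
- by left; exists x.
- by right.
- by exists x; left.
- by exists u; right.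
Qed.

(** The last three hypotheses concern the new vertex in the role of the point, the plane and the
    line of [expt]. Two of these roles at once are excluded by levels or because no vertex is
    adjacent to itself. *)
Lemma iso_extend R u u' P P' l :
  iso R -> source R `<=` built -> target R `<=` built -> built u -> built u' ->
  fresh (source R) l P u -> fresh (target R) l P' u' ->
  (forall x y, R x y -> P x <-> P' y) -> (l = ln -> colour u = colour u') ->
  (forall x y x' y', R x y -> R x' y' -> level x = pl -> level x' = ln ->
    adjacent x x' -> (expt x x' = u <-> expt y y' = u')) ->
  (l = pl -> forall x y x' y', R x y -> R x' y' -> level x = ln -> P x ->
    (expt u x = x' <-> expt u' y = y')) ->
  (l = ln -> forall x y x' y', R x y -> R x' y' -> level x = pl -> P x ->
    (expt x u = x' <-> expt y u' = y')) ->
  iso (extend R u u').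
Proof.
move=> [R1 R2 R3] RX RY bu bu' [ul nu uP] [ul' nu' uP'] PP cu vu pu lu.
have nR y : ~ R u y by move=> Ry; apply: nu; exists y.
have nR' x : ~ R x u' by move=> Rx; apply: nu'; exists x.
have nadj v : built v -> ~ adjacent v v.
  by move=> bv /(adjacent_level bv bv); elim/level_ind: (level v).
have adjE x y : R x y -> adjacent x u <-> adjacent y u'.
  by move=> Rxy; rewrite uP ?uP'; [exact: PP|exists x|exists y].
have bR x y : R x y -> built x /\ built y.
  by move=> Rxy; split; [apply: RX; exists y|apply: RY; exists x].
split.
- move=> x y [/R1//|[-> ->]]; split; first by rewrite ul ul'.
  by rewrite ul => /cu.
- move=> x y x' y' [Rxy|[-> ->]] [Rxy'|[-> ->]].
  + exact: R2.
  + split; last exact: adjE.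
    by split=> E; [case: (nR y)|case: (nR' x)]; rewrite -E.
  + split; last by rewrite adjacentC (adjacentC u'); exact: adjE.
    by split=> E; [case: (nR y')|case: (nR' x')]; rewrite E.
  + by split; split=> // /nadj[].
- move=> x y x' y' x'' y'' [Rxy|[-> ->]] [Rxy'|[-> ->]] [Rxy''|[-> ->]].
  + exact: R3.
  + exact: vu.
  + rewrite ul => xP lE /uP xu; apply: lu => //; apply: xu; by exists y.
  + rewrite ul => xP lE _; have [bx by_] := bR _ _ Rxy; have [xl _] := R1 _ _ Rxy.
    have [_ H _] := exptP bx bu xP (etrans ul lE).
    have [_ H' _] := exptP by_ bu' (etrans (esym xl) xP) (etrans ul' lE).
    by split=> E; [move: H|move: H']; rewrite E ?ul ?ul' lE.
  + rewrite ul => lE xP' /adjacentC/uP xu; apply: pu => //; apply: xu; by exists y'.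
  + rewrite ul => lE xP' _; have [bx by_] := bR _ _ Rxy'; have [xl _] := R1 _ _ Rxy'.
    have [_ H _] := exptP bu bx (etrans ul lE) xP'.
    have [_ H' _] := exptP bu' by_ (etrans ul' lE) (etrans (esym xl) xP').
    by split=> E; [move: H|move: H']; rewrite E ?ul ?ul' lE.
  + by move=> _ _ /nadj[].
  + by move=> _ _ /nadj[].
Qed.

Lemma iso_label R a b c a' b' c' : iso R -> R a a' -> R b b' -> R c c' ->
  flag a b c -> flag a' b' c' /\ label a b c = label a' b' c'.
Proof.
move=> [R1 R2 R3] Ra Rb Rc [aP bP cP ab bc].
have [aP' _] := R1 _ _ Ra; have [bP' /(_ bP) bb'] := R1 _ _ Rb.
have [cP' _] := R1 _ _ Rc.
split; first split.
- by rewrite -aP'.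
- by rewrite -bP'.
- by rewrite -cP'.
- by case: (R2 _ _ _ _ Ra Rb) => _ <-.
- by case: (R2 _ _ _ _ Rb Rc) => _ <-.
rewrite /label /shift bb'; have E := R3 _ _ _ _ _ _ Ra Rb Rc aP bP ab.
by congr (if _ then _ else _); apply/asboolP/asboolP => /E.
Qed.

Lemma iso_sym R : iso R -> iso (fun x y => R y x).
Proof.
move=> [R1 R2 R3]; split.
- by move=> x y /R1[xy cxy]; split=> // xP; rewrite cxy // xy.
- by move=> x y x' y' Rx Rx'; have [E A] := R2 _ _ _ _ Rx Rx'; rewrite E A.
- move=> x y x' y' x'' y'' Rx Rx' Rx'' xP xP' xx'.
  have [_ A] := R2 _ _ _ _ Rx Rx'.
  by rewrite -(R3 _ _ _ _ _ _ Rx Rx' Rx'') ?(R1 _ _ Rx).1 ?(R1 _ _ Rx').1 ?A.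
Qed.

Lemma iso_line_point R a a' u u' w w' P P' :
  iso R -> source R `|` [set u; w] `<=` built ->
  target R `|` [set u'; w'] `<=` built ->
  R a a' -> level a = pl -> P a ->
  (forall x, source R x -> P x -> level x = pl -> x = a) ->
  (forall x y, R x y -> P x <-> P' y) ->
  fresh (source R) ln P u -> fresh (source R `|` [set u]) pt [set u] w ->
  fresh (target R) ln P' u' -> fresh (target R `|` [set u']) pt [set u'] w' ->
  colour u = colour u' -> expt a u = w -> expt a' u' = w' ->
  iso (extend (extend R u u') w w').
Proof.
move=> RI RX RY Raa' aP Pa aU PP uF wF uF' wF' uc ue ue'.
have [R1 R2 R3] := RI.
have [bu bw] : built u /\ built w by split; apply: RX; right; [left|right].
have [bu' bw'] : built u' /\ built w' by split; apply: RY; right; [left|right].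
have bX : source R `<=` built by move=> x Rx; apply: RX; left.
have bY : target R `<=` built by move=> x Rx; apply: RY; left.
have [ul nu uP] := uF; have [ul' nu' uP'] := uF'.
have [wl nw wP] := wF; have [wl' nw' wP'] := wF'.
have aU' x y : R x y -> P x -> level x = pl -> x = a /\ y = a'.
  move=> Rxy Px xP; have xa : x = a by apply: aU => //; exists y.
  by split=> //; apply/(R2 _ _ _ _ Rxy Raa').1.
have I1 : iso (extend R u u').
  apply: (iso_extend RI bX bY bu bu' uF uF' PP) => //.
  - move=> x y x' y' Rx Rx' xP xP' _.
    have bx : built x by apply: bX; exists y.
    have bx' : built x' by apply: bX; exists y'.
    have by_ : built y by apply: bY; exists x.
    have by' : built y' by apply: bY; exists x'.
    have [_ E _] := exptP bx bx' xP xP'.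
    have [_ E' _] : [/\ built (expt y y'), level (expt y y') = pt & adjacent y' (expt y y')].
      by apply: exptP => //; [case: (R1 _ _ Rx) => <-|case: (R1 _ _ Rx') => <-].
    by split=> H; [move: E|move: E']; rewrite H ?ul ?ul'.
  - move=> _ x y x' y' Rx Rx' xP Px; have [-> ->] := aU' _ _ Rx Px xP.
    (* Neither exceptional point has been matched yet, so both equations fail. *)
    rewrite ue ue'; split=> E.
      by case: nw; left; exists y'; rewrite E.
    by case: nw'; left; exists x'; rewrite E.
have bX1 : source (extend R u u') `<=` built.
  by rewrite source_extend => x [/bX|->].
have bY1 : target (extend R u u') `<=` built.
  by rewrite target_extend => x [/bY|->].
have [S1 S2 S3] := I1.
have wF1 : fresh (source (extend R u u')) pt [set u] w by rewrite source_extend.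
have wF1' : fresh (target (extend R u u')) pt [set u'] w' by rewrite target_extend.
have uu' : extend R u u' u u' by right.
have aa' : extend R u u' a a' by left.
apply: (iso_extend I1 bX1 bY1 bw bw' wF1 wF1') => //.
  by move=> x y Rx; exact: (S2 _ _ _ _ Rx uu').1.
move=> x y x' y' Rx Rx' xP xP' xx'.
have bx : built x by apply: bX1; exists y.
have bx' : built x' by apply: bX1; exists y'.
have by_ : built y by apply: bY1; exists x.
have by' : built y' by apply: bY1; exists x'.
have [_ _ A] := exptP bx bx' xP xP'.
have [_ _ A'] : [/\ built (expt y y'), level (expt y y') = pt & adjacent y' (expt y y')].
  by apply: exptP => //; [case: (S1 _ _ Rx) => <-|case: (S1 _ _ Rx') => <-].
(* [u] is the only line through [w], and [a] is the only plane of the domain containing [u]; so [w]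
   is exceptional for the pair (a, u) alone. *)
have key : x' = u -> x = a.
  move=> x'u; case: Rx => [Rx|[xu _]]; last by move: xP; rewrite xu ul.
  rewrite x'u in xx'; apply: aU => //; first by exists y.
  by apply/uP => //; exists y.
have both : x' = u -> [/\ expt x x' = w & expt y y' = w'].
  move=> x'u; have xa := key x'u.
  have -> : y = a' by apply/(S2 _ _ _ _ Rx aa').1.
  have -> : y' = u' by apply/(S2 _ _ _ _ Rx' uu').1.
  by rewrite xa x'u.
have [_ _ wX] := wF1; have [_ _ wX'] := wF1'.
split=> E.
  by rewrite E in A; have /both[] : x' = u by apply/wX => //; exists y'.
rewrite E in A'; have y'u : y' = u' by apply/wX' => //; exists x'.
by have /both[] : x' = u by apply/(S2 _ _ _ _ Rx' uu').1.
Qed.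

(** * Extending isomorphisms along steps *)

Definition extends (R R' : vertex -> vertex -> Prop) := forall x y, R x y -> R' x y.

(** Each step over the source is matched by the corresponding [realise] lemma over the target. *)
Lemma iso_step R U : iso R -> strong (target R) -> step (source R) U ->
  source R `|` U `<=` built ->
  exists R', [/\ extends R R', iso R', source R' = source R `|` U & strong (target R')].
Proof.
move=> RI YS XU bXU; have [R1 R2 R3] := RI.
have bX : source R `<=` built by move=> x Xx; apply: bXU; left.
have bY := strong_built YS.
have bU x : U x -> built x by move=> Ux; apply: bXU; right.
have extl u u' : extends R (extend R u u') by move=> x y; left.
have str x y : R x y -> target R y by exists x.
have src x y : R x y -> source R x by exists y.
have eqv x y x' y' : R x y -> R x' y' -> x = x' <-> y = y'.
  by move=> H H'; have [] := R2 _ _ _ _ H H'.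
have nopt u u' l : level u = l -> level u' = l -> l <> pt ->
    forall x y x' y', R x y -> R x' y' -> level x = pl -> level x' = ln ->
    adjacent x x' -> (expt x x' = u <-> expt y y' = u').
  move=> ul ul' lN x y x' y' Rx Rx' xP xP' _.
  have [_ E _] := exptP (bX _ (src _ _ Rx)) (bX _ (src _ _ Rx')) xP xP'.
  have [yP _] := R1 _ _ Rx; have [yP' _] := R1 _ _ Rx'.
  have [_ E' _] := exptP (bY _ (str _ _ Rx)) (bY _ (str _ _ Rx'))
    (etrans (esym yP) xP) (etrans (esym yP') xP').
  by split=> H; case: lN; [rewrite -ul -H|rewrite -ul' -H].
case: XU bU {bXU}.
- move=> b u [b' Rb] bP uF ub bU.
  have bP' : level b' = ln by case: (R1 _ _ Rb) => <-.
  have [u' [uF' ub' S]] := realise_point YS (str _ _ Rb) bP'.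
  have bu : built u by apply: bU.
  have bu' : built u' by apply: (strong_built S); right.
  exists (extend R u u'); split; rewrite ?source_extend ?target_extend //.
  apply: (iso_extend RI bX bY bu bu' uF uF') => //.
    by move=> x y Rx; exact: eqv Rx Rb.
  move=> x y x' y' Rx Rx' xP xP' xx'.
  have yy' : adjacent y y' by case: (R2 _ _ _ _ Rx Rx') => _ <-.
  have [yP _] := R1 _ _ Rx; have [yP' _] := R1 _ _ Rx'.
  have [_ _ A] := exptP (bX _ (src _ _ Rx)) (bX _ (src _ _ Rx')) xP xP'.
  have [_ _ A'] := exptP (bY _ (str _ _ Rx)) (bY _ (str _ _ Rx'))
    (etrans (esym yP) xP) (etrans (esym yP') xP').
  have [_ _ uX] := uF; have [_ _ uY] := uF'.
  split=> E; [rewrite E in A|rewrite E in A'].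
    have x'b := (uX _ (src _ _ Rx')).1 A.
    by case: (ub x (src _ _ Rx) xP); rewrite -x'b.
  have y'b := (uY _ (str _ _ Rx')).1 A'.
  by case: (ub' y (str _ _ Rx) (etrans (esym yP) xP)); rewrite -y'b.
- move=> b u [b' Rb] bP uF [c' Rc] bU.
  have bu : built u by apply: bU.
  have [uP _ uX] := uF.
  have ub : adjacent b u by apply/uX => //; exists b'.
  have bP' : level b' = ln by case: (R1 _ _ Rb) => <-.
  have [_ cP bc] := exptP bu (bX _ (src _ _ Rb)) uP bP.
  have cP' : level c' = pt by case: (R1 _ _ Rc) => <-.
  have bc' : adjacent b' c' by case: (R2 _ _ _ _ Rb Rc) => _ <-.
  have [u' [uF' ue S]] := realise_plane YS (str _ _ Rb) (str _ _ Rc) bP' cP' bc'.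
  have bu' : built u' by apply: (strong_built S); right.
  exists (extend R u u'); split; rewrite ?source_extend ?target_extend //.
  have [uP' _ _] := uF'.
  apply: (iso_extend RI bX bY bu bu' uF uF') => //.
  + by move=> x y Rx; exact: eqv Rx Rb.
  + exact: nopt uP uP' _.
  + move=> _ x y x' y' Rx Rx' _ /= xb.
    have -> : y = b' by apply/(eqv _ _ _ _ Rx Rb).
    by rewrite xb ue; exact: eqv Rc Rx'.
- move=> a c u uF ue [b [[a' Ra] [b' Rb] [c' Rc] F lE]] bU.
  have bu : built u by apply: bU.
  have [F' lE'] := iso_label RI Ra Rb Rc F.
  have [u' [uF' ue' lu' S]] :=
    realise_line_between YS (str _ _ Ra) (str _ _ Rb) (str _ _ Rc) F'.
  have bu' : built u' by apply: (strong_built S); right.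
  have [aP _ cP _ _] := F; have [uP _ _] := uF; have [uP' _ _] := uF'.
  exists (extend R u u'); split; rewrite ?source_extend ?target_extend //.
  apply: (iso_extend RI bX bY bu bu' uF uF') => //.
  + move=> x y Rx /=; split=> -[]; [left|right|left|right].
    * exact/(eqv _ _ _ _ Rx Ra).
    * exact/(eqv _ _ _ _ Rx Rc).
    * exact/(eqv _ _ _ _ Rx Ra).
    * exact/(eqv _ _ _ _ Rx Rc).
  (* [c] and [c'] are exceptional on the new lines, whose colours are therefore the predecessor of
     the common index. *)
  + move=> _; apply: (can_inj (@ordSK k)); move: lE; rewrite lE' lu'.
    by rewrite /label /shift ue ue' !asboolT.
  + exact: nopt uP uP' _.
  + move=> _ x y x' y' Rx Rx' xP [/= xa|/= xc]; last by rewrite xc cP in xP.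
    have -> : y = a' by apply/(eqv _ _ _ _ Rx Ra).
    by rewrite xa ue ue'; exact: eqv Rc Rx'.
- move=> a c u w uF wF ue [b [[a' Ra] [b' Rb] [c' Rc] F lE]] bU.
  have [F' lE'] := iso_label RI Ra Rb Rc F.
  have [u' [w' [uF' wF' ue' lu' S]]] :=
    realise_line_point_between YS (str _ _ Ra) (str _ _ Rb) (str _ _ Rc) F'.
  have [aP _ cP _ _] := F.
  exists (extend (extend R u u') w w').
  split; rewrite ?source_extend ?target_extend -?setUA //.
    by move=> x y Rx; left; left.
  apply: (@iso_line_point R a a' _ _ _ _ [set a; c] [set a'; c']) => //.
  + by move=> x [/bX|/bU].
  + exact: strong_built S.
  + by left.
  + by move=> x _ [//|/= xc]; rewrite xc cP.
  + move=> x y Rx /=; split=> -[]; [left|right|left|right].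
    * exact/(eqv _ _ _ _ Rx Ra).
    * exact/(eqv _ _ _ _ Rx Rc).
    * exact/(eqv _ _ _ _ Rx Ra).
    * exact/(eqv _ _ _ _ Rx Rc).
  (* Here [c] and [c'] are ordinary on the new lines, whose colours therefore equal the common
     index. *)
  + have nwc : w <> c by move=> wc; case: wF => _ + _; apply; left; rewrite wc; apply: src Rc.
    have nwc' : w' <> c' by move=> wc; case: wF' => _ + _; apply; left; rewrite wc; apply: str Rc.
    by move: lE; rewrite lE' lu' /label /shift ue ue' !asboolF.
- move=> a u w [a' Ra] aP uF wF ue bU.
  have aP' : level a' = pl by case: (R1 _ _ Ra) => <-.
  have [u' [w' [uF' wF' ue' uc S]]] :=
    realise_line_point YS (colour u) (str _ _ Ra) aP'.
  exists (extend (extend R u u') w w').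
  split; rewrite ?source_extend ?target_extend -?setUA //.
    by move=> x y Rx; left; left.
  apply: (@iso_line_point R a a' _ _ _ _ [set a] [set a']) => //.
  + by move=> x [/bX|/bU].
  + exact: strong_built S.
  + by move=> x y Rx; exact: eqv Rx Ra.
- move=> c u [c' Rc] cP uF bU.
  have bu : built u by apply: bU.
  have cP' : level c' = pt by case: (R1 _ _ Rc) => <-.
  have [u' [uF' uc S]] := realise_line_through YS (colour u) (str _ _ Rc) cP'.
  have bu' : built u' by apply: (strong_built S); right.
  have [uP _ _] := uF; have [uP' _ _] := uF'.
  exists (extend R u u'); split; rewrite ?source_extend ?target_extend //.
  apply: (iso_extend RI bX bY bu bu' uF uF') => //.
  + by move=> x y Rx; exact: eqv Rx Rc.
  + exact: nopt uP uP' _.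
  + by move=> _ x y x' y' Rx Rx' xP /= xc; rewrite xc cP in xP.
- move=> u uF bU.
  have bu : built u by apply: bU.
  have [u' [uF' uc S]] := realise_line YS (colour u).
  have bu' : built u' by apply: (strong_built S); right.
  have [uP _ _] := uF; have [uP' _ _] := uF'.
  exists (extend R u u'); split; rewrite ?source_extend ?target_extend //.
  apply: (iso_extend RI bX bY bu bu' uF uF') => //.
  exact: nopt uP uP' _.
Qed.

Lemma iso_ext X Z R : ext X Z -> Z `<=` built -> iso R -> source R = X ->
  strong (target R) ->
  exists R', [/\ extends R R', iso R', source R' = Z & strong (target R')].
Proof.
move=> XZ; elim: XZ R => {X Z} [X|X U Z XU UZ IH] R bZ RI RX YS.
  by exists R; split=> //; apply: strong_built.
subst X; have bU : source R `|` U `<=` built by move=> x /(ext_sub UZ)/bZ.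
have [R1 [RR1 R1I R1X R1Y]] := iso_step RI YS XU bU.
have [R2 [RR2 R2I R2X R2Y]] := IH R1 bZ R1I R1X R1Y.
by exists R2; split=> // x y /RR1/RR2.
Qed.

Definition strong_iso R := [/\ iso R, strong (source R) & strong (target R)].

Lemma strong_iso_sym R : strong_iso R -> strong_iso (fun x y => R y x).
Proof. by move=> [RI XS YS]; split=> //; apply: iso_sym. Qed.

Lemma forth R v : strong_iso R -> built v ->
  exists R', [/\ extends R R', strong_iso R' & source R' v].
Proof.
move=> [RI [Z ZC XZ] YS] bv; have [Z' [ZC' ZZ' Z'v]] := grow ZC bv.
have [R' [RR' R'I R'X R'Y]] :=
  iso_ext (ext_trans XZ ZZ') (closed_built ZC') RI erefl YS.
exists R'; split=> //; last by rewrite R'X.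
by split=> //; rewrite R'X; exists Z' => //; apply: ext_refl.
Qed.

(** The joining line [b] need not lie in the domain; by [ext_label] a line of the domain joins the
    same vertices with the same index, and that one can be mapped. *)
Lemma strong_iso_label R a b c a' c' : strong_iso R -> R a a' -> R c c' ->
  built_flag a b c ->
  exists b', built_flag a' b' c' /\ label a' b' c' = label a b c.
Proof.
move=> [RI [Z ZC XZ] YS] Ra Rc [ba bb bc F].
have [Z' [ZC' ZZ' Z'b]] := grow ZC bb.
have [||b0 [[b0' Rb0] F0 <-]] := ext_label (ext_trans XZ ZZ') _ _ Z'b F.
- by exists a'.
- by exists c'.
have [F' ->] := iso_label RI Ra Rb0 Rc F0.
exists b0'; split=> //; split=> //; apply: (strong_built YS).
- by exists a.
- by exists b0.
- by exists c.
Qed.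

(** * The coloured pseudospace *)

Local Notation built_vertex := {u : vertex | built u}.

(** The index of a point in a plane is read off from any joining line; [label_uniq] makes the choice
    immaterial. *)
Definition coloured_pseudospace : structure (cps_sig k) :=
  @Structure (cps_sig k) built_vertex
    (fun r => match r with
     | Geo r' => fun t => @interp ps_sig free_pseudospace r' t
     | Colour i => fun t : 1.-tuple built_vertex =>
         level (sval (tnth t ord0)) = ln /\ colour (sval (tnth t ord0)) = i
     | Incidence i => fun t : 2.-tuple built_vertex =>
         exists b, built_flag (sval (tnth t ord0)) b (sval (tnth t ord_max)) /\
           label (sval (tnth t ord0)) b (sval (tnth t ord_max)) = i
     end).
Local Notation N := coloured_pseudospace.

(* [lift_ps] is restricted to variables in [Set], which rules out [elim]. *)
Lemma sat_lift_ps (V : Set) (f : formula ps_sig V) (v : V -> built_vertex) :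
  @sat (cps_sig k) N V v (lift_ps k f) <-> @sat ps_sig free_pseudospace V v f.
Proof.
move: V f v; fix IH 2 => V [|x y|r t|f g|f g|f g|f|f] v //=.
- by rewrite (IH _ f) (IH _ g).
- by rewrite (IH _ f) (IH _ g).
- by rewrite (IH _ f) (IH _ g).
- by split=> H a; have := H a; rewrite (IH _ f).
- by split=> -[a H]; exists a; move: H; rewrite (IH _ f).
Qed.

Lemma sat_Col (V : Type) (v : V -> N) i b : sat v (Col i b) <->
  level (sval (v b)) = ln /\ colour (sval (v b)) = i.
Proof. by []. Qed.

Lemma sat_line_in (V : Type) (v : V -> N) b a : sat v (line_in k b a) <->
  [/\ level (sval (v b)) = ln, level (sval (v a)) = pl
    & adjacent (sval (v a)) (sval (v b))].
Proof. by split=> [[[]]|[]]. Qed.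

Lemma sat_point_on (V : Type) (v : V -> N) c b : sat v (point_on k c b) <->
  [/\ level (sval (v c)) = pt, level (sval (v b)) = ln
    & adjacent (sval (v b)) (sval (v c))].
Proof. by split=> [[[]]|[]]. Qed.

Lemma sat_Inc (V : Type) (v : V -> N) i a c : sat v (Inc i a c) <->
  exists b, built_flag (sval (v a)) b (sval (v c)) /\
    label (sval (v a)) b (sval (v c)) = i.
Proof. by []. Qed.

Lemma sat_point_in (V : Type) (v : V -> N) c a : sat v (point_in k c a) <->
  exists b, built_flag (sval (v a)) b (sval (v c)).
Proof.
split=> [[x [xa cx]]|].
  have [/= bP aP ab] := iffLR (@sat_line_in _ (oapp v x) None (Some a)) xa.
  have [/= cP _ bc] := iffLR (@sat_point_on _ (oapp v x) (Some c) None) cx.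
  by exists (sval x); split=> //; apply: svalP.
move=> [b [_ bb _ [aP bP cP ab bc]]].
pose x : N := exist _ b bb; exists x; split.
  by apply/(@sat_line_in _ (oapp v x)); split.
by apply/(@sat_point_on _ (oapp v x)); split.
Qed.

Lemma built_vertex_inj : injective (sval : built_vertex -> vertex).
Proof.
by move=> x y; apply: eq_sig_hprop => ? ? ?; apply: Prop_irrelevance.
Qed.

Lemma same_type R (V : Type) (f : formula (cps_sig k) V) (v v' : V -> N) :
  strong_iso R -> (forall x, R (sval (v x)) (sval (v' x))) ->
  sat v f <-> sat v' f.
Proof.
move=> RS vv'.
pose lift (R : vertex -> vertex -> Prop) (x y : N) := R (sval x) (sval y).
pose F := [set Q | exists2 R, strong_iso R & Q = lift R].
apply: (@back_and_forth _ _ _ F _ _ _ _ (lift R)) => //; last by exists R.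
- move=> _ [{vv' RS}R [[_ RI _] _ _] ->] x x' y y' Rx Ry.
  have [E _] := RI _ _ _ _ Rx Ry.
  by split=> xy; apply/built_vertex_inj/E; rewrite xy.
- move=> _ [{vv' RS}R RS ->] [[l|]|i|i] t t' tt'.
  + have [[R1 _ _] _ _] := RS; have [E _] := R1 _ _ (tt' ord0).
    by rewrite /= E.
  + have [[_ R2 _] _ _] := RS.
    by have [_ E] := R2 _ _ _ _ (tt' ord0) (tt' ord_max).
  + have [[R1 _ _] _ _] := RS; have [E C] := R1 _ _ (tt' ord0).
    rewrite /= E; split=> -[tl ti]; split=> //; move: ti; rewrite C // E //.
  + split=> -[b [BF lE]].
      have [b' [BF' lE']] := strong_iso_label RS (tt' ord0) (tt' ord_max) BF.
      by exists b'; rewrite lE'.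
    have [b' [BF' lE']] :=
      strong_iso_label (strong_iso_sym RS) (tt' ord0) (tt' ord_max) BF.
    by exists b'; rewrite lE'.
- move=> _ [{vv' RS}R RS ->] x.
  have [R' [RR' RS' [y Rxy]]] := forth RS (svalP x).
  exists (lift R'); first by exists R'.
  split; first by move=> z z'; apply: RR'.
  have [_ _ YS] := RS'; have by_ : built y by apply: (strong_built YS); exists (sval x).
  by exists (exist _ y by_).
- move=> _ [{vv' RS}R RS ->] x.
  have [R' [RR' RS' [y Rxy]]] := forth (strong_iso_sym RS) (svalP x).
  exists (lift (fun a b => R' b a)).
    by exists (fun a b => R' b a) => //; apply: strong_iso_sym.
  split; first by move=> z z'; apply: RR'.
  have [_ _ YS] := RS'; have by_ : built y by apply: (strong_built YS); exists (sval x).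
  by exists (exist _ y by_).
Qed.

Lemma sat_Inc_label (V : Type) (v : V -> N) a b c :
  built_flag (sval (v a)) b (sval (v c)) ->
  sat v (Inc (label (sval (v a)) b (sval (v c))) a c).
Proof. by move=> F; exists b. Qed.

Lemma sat_is_expt (V : Type) (v : V -> N) a b c :
  flag (sval (v a)) (sval (v b)) (sval (v c)) ->
  expt (sval (v a)) (sval (v b)) = sval (v c) -> sat v (is_expt k a b c).
Proof.
move=> F abc; have [aP bP cP ab bc] := F.
split; first by split; [apply/sat_line_in|apply/sat_point_on].
apply/sat_big_or_enum; exists (colour (sval (v b))); split.
  by apply/sat_Col.
apply/sat_Inc; exists (sval (v b)); split.
  by split=> //; apply: svalP.
by rewrite /label /shift asboolT.
Qed.

Lemma built_line j a b c : built_flag a b c ->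
  [/\ built (New j a b c ln ln ln), adjacent a (New j a b c ln ln ln)
    & adjacent (New j a b c ln ln ln) c].
Proof. by move=> F; have [_ ? _ [_ _ _ ? ?]] := built_flag_new_flag j ln ln F. Qed.

(** The lines are those added by {1} to one flag. In the applications [index] selects the parity:
    odd for the colour equal to the index of the point, even for the preceding colour. *)
Lemma at_least_lines (V : Set) (v : V -> N) a b c n i
    (index : nat -> nat) (x := v a) (z := v c) :
  built_flag (sval x) b (sval z) -> injective index ->
  (forall m, colour (New (index m) (sval x) b (sval z) ln ln ln) = i) ->
  sat v (at_least n [::] (line_in k None (Some a) && point_on k (Some c) None
                          && Col i None)%F).
Proof.
move=> F inj ci.
have B m : built (New (index m) (sval x) b (sval z) ln ln ln).
  by have [] := built_line (index m) F.
apply: (@sat_at_least _ _ _ _ _ _ _ (fun m => exist _ _ (B m) : N)).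
  by move=> m m' /(congr1 sval)[/inj].
move=> m; have [_ xy yz] := built_line (index m) F; have [_ _ _ [xP _ zP _ _]] := F.
split; first split.
- by apply/(@sat_line_in _ (oapp v _)).
- by apply/(@sat_point_on _ (oapp v _)).
- by apply/sat_Col; rewrite /= -(ci m).
Qed.

Lemma coloured_model : model (CPS k) N.
Proof.
move=> _ [s /= sP|i|| i j ij|i||i j ij|i||i n|i n|n].
- by rewrite /holds sat_lift_ps.
- by move=> b [].
- by move=> b bP; apply/sat_big_or_enum; exists (colour (sval b)); split.
- move=> b [/sat_Col[_ bi] /sat_Col[_ bj]]; move: ij; by rewrite -bi -bj eqxx.
- by move=> a c [b [F _]]; apply/sat_point_in; exists b.
- move=> a c /sat_point_in[b F].
  by apply/sat_big_or_enum; exists (label (sval a) b (sval c)); exists b.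
- move=> a c [[b [F bi]] [b' [F' bj]]]; move/eqP: ij; apply.
  rewrite -bi -bj; exact: label_uniq F F'.
- move=> a b [ab /sat_Col[_ bi]].
  have [bP aP {}ab] := iffLR (sat_line_in _ _ _) ab.
  have F c : sat (oapp (oapp (oapp (of_void N) a) b) c) (point_on k None (Some None)) ->
      built_flag (sval a) (sval b) (sval c).
    by move=> /sat_point_on[cP _ bc]; split=> //; apply: svalP.
  split=> [c /F bc|c d [[[cb db] nc] nd]].
    have := @sat_Inc_label _ (oapp (oapp (oapp (of_void N) a) b) c)
      (Some (Some None)) (sval b) None bc.
    by rewrite /label /shift /= bi; case: ifP; [right|left].
  (* An ordinary point of [b] has index [i] in the plane; so two points of [b] of other indices are
     both exceptional and coincide. *)
  have E (x : N) : built_flag (sval a) (sval b) (sval x) ->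
      ~ (exists b', built_flag (sval a) b' (sval x) /\
         label (sval a) b' (sval x) = i) ->
      expt (sval a) (sval b) = sval x.
    move=> BF nI; apply: contrapT => nx; apply: nI; exists (sval b); split=> //.
    by rewrite /label /shift asboolF.
  apply: built_vertex_inj; rewrite -(E c) ?(E d) //; exact: F.
- move=> a b /sat_line_in[bP aP ab].
  have [ce cP bc] := exptP (svalP a) (svalP b) aP bP.
  by exists (exist _ _ ce : N); apply: sat_is_expt.
- move=> a c [b [F <-]].
  apply: (@at_least_lines _ _ _ b _ _ _ (fun m => m.*2.+1)) => //.
    by move=> m m' [/double_inj].
  by move=> m; rewrite /= odd_double.
- move=> a c [b [F <-]].
  apply: (@at_least_lines _ _ _ b _ _ _ double) => //; first exact: double_inj.
  by move=> m; rewrite /= odd_double.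
- move=> b c /sat_point_on[cP bP bc].
  (* The letter {2}, applied repeatedly to one flag through [b] and [c], gives the planes. *)
  have [a [b' [c' [[ba bb bc' [aP _ _ ab _]]]]]] := in_flag (svalP b).
  rewrite bP /flag_vertex /= => bE; subst b'.
  have F : built_flag a (sval b) (sval c) by split=> //; apply: svalP.
  have G m := built_flag_new_flag m pl pl F.
  have B m : built (New m a (sval b) (sval c) pl pl pl) by case: (G m).
  apply: (@sat_at_least _ _ _ _ _ _ _ (fun m => exist _ _ (B m) : N)).
    by move=> m m' /(congr1 sval)[].
  move=> m; apply: sat_is_expt; first by case: (G m).
  by rewrite /= asboolT.
Qed.

(** * The cycle of types *)

Definition expt_flag i a b c :=
  [/\ strong [set a; b; c], flag a b c, expt a b = c & colour b = i].

Lemma not_adjacent_level x y l l' : built x -> built y -> level x = l ->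
  level y = l' -> ~~ consecutive l l' -> ~ adjacent x y.
Proof.
by move=> bx by_ <- <- /negbTE nc /(adjacent_level bx by_); rewrite nc.
Qed.

Lemma expt_flag_iso i a b c a' b' c' : expt_flag i a b c -> expt_flag i a' b' c' ->
  exists R, [/\ strong_iso R, R a a' & R c c'].
Proof.
move=> [S F e bi] [S' F' e' bi'].
have [ba bb bc] : [/\ built a, built b & built c].
  by split; apply: (strong_built S); [left; left|left; right|right].
have [ba' bb' bc'] : [/\ built a', built b' & built c'].
  by split; apply: (strong_built S'); [left; left|left; right|right].
have [aP bP cP ab bc_] := F; have [aP' bP' cP' ab' bc_'] := F'.
pose R x y := [\/ x = a /\ y = a', x = b /\ y = b' | x = c /\ y = c'].
have srcR : source R = [set a; b; c].
  apply/seteqP; split=> x.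
    by case=> y [[-> _]|[-> _]|[-> _]]; [left; left|left; right|right].
  case=> [[->|->]|->]; [exists a'|exists b'|exists c'].
  - by apply: Or31.
  - by apply: Or32.
  - by apply: Or33.
have tgtR : target R = [set a'; b'; c'].
  apply/seteqP; split=> x.
    by case=> y [[_ ->]|[_ ->]|[_ ->]]; [left; left|left; right|right].
  case=> [[->|->]|->]; [exists a|exists b|exists c].
  - by apply: Or31.
  - by apply: Or32.
  - by apply: Or33.
have nlev (x y : vertex) l l' : level x = l -> level y = l' -> l <> l' -> x <> y.
  by move=> <- <- h E; apply: h; rewrite E.
have neq x y x' y' l l' : level x = l -> level y = l' -> level x' = l ->
    level y' = l' -> l <> l' -> x = y <-> x' = y'.
  by move=> h1 h2 h3 h4 ll'; split=> [/(nlev _ _ _ _ h1 h2 ll')|/(nlev _ _ _ _ h3 h4 ll')].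
have nad x y x' y' l l' : built x -> built y -> built x' -> built y' ->
    level x = l -> level y = l' -> level x' = l -> level y' = l' ->
    ~~ consecutive l l' -> adjacent x y <-> adjacent x' y'.
  move=> ? ? ? ? h1 h2 h3 h4 h; split=> H; exfalso.
    exact: not_adjacent_level h1 h2 h H.
  exact: not_adjacent_level h3 h4 h H.
exists R; split; [|by apply: Or31|by apply: Or33].
split; rewrite ?srcR ?tgtR //; split.
- move=> x y [[-> ->]|[-> ->]|[-> ->]]; rewrite ?aP ?aP' ?bP ?bP' ?cP ?cP' //.
  by split=> // _; rewrite bi bi'.
- move=> x y x' y' [[-> ->]|[-> ->]|[-> ->]] [[-> ->]|[-> ->]|[-> ->]]; split => //;
    try (by apply: neq; eauto); try (by apply: nad; eauto).
  + by split=> _; apply: adj_sym.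
  + by split=> _; apply: adj_sym.
- move=> x y x' y' x'' y'' [[-> ->]|[-> ->]|[-> ->]] [[-> ->]|[-> ->]|[-> ->]];
    rewrite ?aP ?bP ?cP // => Rx'' _ _ _; rewrite e e'.
  case: Rx'' => -[-> ->] //.
    by apply: neq; eauto.
  by apply: neq; eauto.
Qed.

(* Let [u] be a new line of colour [i] in [a] with [d] as its exceptional point.
   Then [a - u - d] is strong, because [b] and [c] can be added back freely over
   it. *)
Lemma expt_flag_ordinary i a b c d : strong [set a; b; c; d] -> flag a b c ->
  flag a b d -> expt a b = c -> c <> d -> colour b = ordS i ->
  exists u, expt_flag i a u d.
Proof.
move=> S F F' e cd bi; have [aP bP cP ab bc] := F; have [_ _ dP _ bd] := F'.
set X := [set a; b; c; d] in S.
have [Xa Xb Xc Xd] : [/\ X a, X b, X c & X d].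
  by split; [left; left; left|left; left; right|left; right|right].
have [u [uF ue ul US]] := realise_line_between S Xa Xb Xd F'.
have [uP nXu uX] := uF.
have UF : flag a u d.
  by split=> //; [apply/uX => //; left|apply/adj_sym/uX => //; right].
have bX x : X x -> built x by apply: strong_built S _.
have bu : built u by apply: (strong_built US); right.
exists u; split=> //; last first.
  (* [d] is ordinary on [b], of colour i + 1, and exceptional on [u]; both lines give it the same
     index, so [u] has colour [i]. *)
  apply: (can_inj (@ordSK k)); rewrite -bi; move: ul.
  by rewrite /label /shift ue e asboolF // asboolT.
apply: ext_strong US.
have -> : X `|` [set u] = [set a; u; d] `|` [set b; c].
  rewrite /X; apply/seteqP; split=> x /=; tauto.
have nb : b <> u by move=> E; apply: nXu; rewrite -E.
have nl x y : level x <> level y -> x <> y by move=> h E; apply: h; rewrite E.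
(* Now [b] counts as a line added between [a] and [d], anchored by [u], and [c] as its exceptional
   point added along with it. *)
apply: ext1; apply: (@step_line_point_between _ a d) => //.
- split=> //.
    by case=> [[|//]|]; apply: nl; rewrite bP ?aP ?dP.
  move=> x [[->|->]|->]; split=> //.
  + by left.
  + by move=> A; case: (not_adjacent_level bu (bX _ Xb) uP bP isT A).
  + by case=> /nl[]; rewrite uP ?aP ?dP.
  + by right.
  + by move=> _; apply: adj_sym.
- split=> //.
    case=> [[[|cu]|//]|]; try (by apply: nl; rewrite cP ?aP ?bP).
    by apply: nXu; rewrite -cu.
  move=> x [[[->|->]|->]|->]; split=> //.
  + by move=> A; case: (not_adjacent_level (bX _ Xa) (bX _ Xc) aP cP isT A).
  + by move=> /nl[]; rewrite aP bP.
  + move=> /adj_sym/(uX _ Xc)[/nl[]|//].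
    by rewrite cP aP.
  + by move=> /esym.
  + by move=> A; case: (not_adjacent_level (bX _ Xd) (bX _ Xc) dP cP isT A).
  + by move=> /nl[]; rewrite dP bP.
- exists u; split=> //; [by left; left|by left; right|by right].
Qed.

(** * A strong line with infinitely many points, each exceptional in its own plane *)

Section Fan.
Variables (Z : set vertex) (a b c : vertex).
Hypotheses (ZC : closed Z) (Za : Z a) (Zb : Z b) (Zc : Z c) (F : flag a b c).
Hypothesis bZ : ext [set b] Z.
Hypothesis new : forall n l, ~ Z (New n a b c pt pt l).

Definition fan_point n := New n a b c pt pt pt.
Definition fan_plane n := New 0 a b (fan_point n) pl pl pl.

Fixpoint stage n : set vertex :=
  if n is m.+1 then stage m `|` [set fan_point m] `|` [set fan_plane m] else Z.

Fixpoint subfan (J J' : pred nat) n : set vertex :=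
  if n is m.+1 then
    subfan J J' m `|` (if J m then [set fan_point m] else set0)
                  `|` (if J' m then [set fan_plane m] else set0)
  else [set b].

Lemma subfanP J J' n v : subfan J J' n v <-> v = b \/
  exists m, m < n /\ (J m /\ v = fan_point m \/ J' m /\ v = fan_plane m).
Proof.
elim: n => [|n IH] /=.
  by split; [move=> ->; left|case=> // -[m []]].
split=> [[[/IH[->|[m [mn H]]]|]|]|].
- by left.
- by right; exists m; split=> //; apply: ltnW.
- by case: ifP => // Jn ->; right; exists n; split=> //; left.
- by case: ifP => // Jn ->; right; exists n; split=> //; right.
case=> [vb|[m []]]; first by left; left; apply/IH; left.
rewrite ltnS leq_eqVlt => /orP[/eqP->|mn H].
  by case=> -[-> ->]; [left; right|right].
by left; left; apply/IH; right; exists m.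
Qed.

Lemma stage_old n v : stage n v ->
  Z v \/ exists2 m, m < n & v = fan_point m \/ v = fan_plane m.
Proof.
elim: n => [|n IH] /=; first by left.
case=> [[/IH[Zv|[m mn H]]|->]|->]; [by left|right..].
- by exists m => //; apply: ltnW.
- by exists n => //; left.
- by exists n => //; right.
Qed.

Lemma flag_fan n : flag a b (fan_point n).
Proof.
have [aP bP cP ab bc] := F; split=> //.
by apply: adj_sym; apply: (@adj_new n a b c pt pt pt ln).
Qed.

Lemma stage_unused n m l : n <= m -> ~ stage n (New m a b c pt pt l).
Proof.
move=> nm /stage_old[/new//|[m' m'n []]] // -[mm' _].
by move: m'n; rewrite -mm' ltnNge nm.
Qed.

(** From one stage to the next, a selected vertex is added to both sides, and an omitted one is a
    further step on the larger side. The inclusion of [J'] in [J] keeps the exceptional point of a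
    selected plane among the selected vertices. *)
Lemma fan_strong (J J' : pred nat) n : (forall m, J' m -> J m) ->
  closed (stage n) /\ ext (subfan J J' n) (stage n).
Proof.
move=> JJ'; elim: n => [|n [SC SE]] //=.
have Zn v : Z v -> stage n v.
  by move=> Zv; elim: n {SC SE} => [//|n IH]; left; left.
have nu : unused (stage n) n a b c pt pt.
  by move=> l _; apply: stage_unused.
have S1C : closed (stage n `|` [set fan_point n]).
  by rewrite -block_point; apply: closed_block => //; apply: Zn.
have nu' : unused (stage n `|` [set fan_point n]) 0 a b (fan_point n) pl pl.
  move=> l _ [/(closed_parents SC)[_ _]|//].
  exact: stage_unused.
have S2C : closed (stage n `|` [set fan_point n] `|` [set fan_plane n]).
  rewrite -block_plane; apply: closed_block => //; try by left; apply: Zn.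
    by right.
  exact: flag_fan.
split=> //.
have [pF pe] := letter_point SC (Zn _ Zb) F nu.
have [qF qe] := letter_plane S1C nu'.
have bP : level b = ln by case: F.
have bX : subfan J J' n b by apply/subfanP; left.
have S1E : ext (subfan J J' n `|` (if J n then [set fan_point n] else set0))
    (stage n `|` [set fan_point n]).
  case: ifP => _; first by apply: ext_free => //; apply: (free_over1 pF) => // x ->.
  rewrite setU0; apply: ext_trans SE _; apply: ext1.
  exact: step_point (Zn _ Zb) bP pF pe.
case J'n: (J' n); last first.
  rewrite setU0; apply: ext_trans S1E _; apply: ext1.
  apply: (@step_plane _ b) => //; first by left; apply: Zn.
  by rewrite qe; right.
rewrite JJ' // in S1E *; apply: ext_free => //.
apply: (free_over1 qF) => [x ->|_ b' Sb' b'q]; first by left.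
have [_ _ /(_ _ Sb')/iffLR/(_ b'q) ->] := qF.
by rewrite qe; right.
Qed.

Lemma strong_subfan (J J' : pred nat) n : (forall m, J' m -> J m) -> strong (subfan J J' n).
Proof. by move=> /(@fan_strong J J' n)[SC SE]; exists (stage n). Qed.

Lemma expt_fan n : expt (fan_plane n) b = fan_point n.
Proof. by rewrite /= asboolT. Qed.

Lemma flag_fan_plane n m : flag (fan_plane n) b (fan_point m).
Proof.
have [_ bP _ _ bc] := flag_fan m; split=> //.
by apply: (@adj_new 0 a b _ pl pl pl ln).
Qed.

Lemma expt_flag_fan i n : colour b = i ->
  expt_flag i (fan_plane n) b (fan_point n).
Proof.
move=> bi; split=> //; [|exact: flag_fan_plane|exact: expt_fan].
rewrite (_ : [set _; _; _] = subfan (pred1 n) (pred1 n) n.+1).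
  exact: strong_subfan.
apply/seteqP; split=> v; rewrite subfanP.
  case=> [[->|->]|->]; [right|by left|right]; exists n; split=> //; [right|left];
    by split=> //=.
case=> [->|[m [_ [[/eqP-> ->]|[/eqP-> ->]]]]].
- by left; right.
- by right.
- by left; left.
Qed.

Lemma ordinary_fan i n m : colour b = ordS i -> n != m ->
  exists u, expt_flag i (fan_plane n) u (fan_point m).
Proof.
move=> bi nm.
apply: (@expt_flag_ordinary i (fan_plane n) b (fan_point n)) => //.
(* The points [n], [m] and the plane [n] are selected; the bound exceeds both indices. *)
- rewrite (_ : [set _; _; _; _] = subfan (pred2 n m) (pred1 n) (n + m).+1).
    by apply: strong_subfan => x /= ->.
  apply/seteqP; split=> v; rewrite subfanP.
    case=> [[[->|->]|->]|->]; [right|by left|right|right].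
    + by exists n; split; [rewrite ltnS leq_addr|right; rewrite /= eqxx].
    + by exists n; split; [rewrite ltnS leq_addr|left; rewrite /= eqxx].
    + by exists m; split; [rewrite ltnS leq_addl|left; rewrite /= eqxx orbT].
  case=> [->|[m' [_ [[/orP[]/eqP-> ->]|[/eqP-> ->]]]]].
  + by left; left; right.
  + by left; right.
  + by right.
  + by left; left; left.
- exact: flag_fan_plane.
- exact: flag_fan_plane.
- exact: expt_fan.
- by move=> [/eqP]; rewrite (negbTE nm).
Qed.

Lemma increasing_inj n (s : 'I_n -> nat) :
  {homo s : i j / i < j} -> forall i j, s i = s j <-> i = j.
Proof.
move=> sP i j; split=> [|->//].
by case: (ltngtP i j) => [/sP|/sP|/val_inj//]; [move=> + E|move=> + E]; rewrite E ltnn.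
Qed.

(** The line with any finite set of fan points is strong, and all these points are related to it
    alike; so fixing [b] and matching the points in order gives a strong isomorphism. *)
Lemma fan_indiscernible n (s t : 'I_n -> nat) :
  {homo s : i j / i < j} -> {homo t : i j / i < j} ->
  exists2 R, strong_iso R & forall i, R (fan_point (s i)) (fan_point (t i)).
Proof.
move=> sP tP.
pose R x y := (x = b /\ y = b) \/ exists i, x = fan_point (s i) /\ y = fan_point (t i).
have points (r : 'I_n -> nat) : [set v | v = b \/ exists i, v = fan_point (r i)] =
    subfan [pred m | m \in codom r] pred0 (\max_i r i).+1.
  apply/seteqP; split=> v; rewrite subfanP.
    case=> [->|[i ->]]; [by left|right; exists (r i)]; split.
      by rewrite ltnS leq_bigmax.
    by left; split=> //=; apply: codom_f.
  by case=> [->|[m [_ [[/codomP[i ->] ->]|[]//]]]]; [left|right; exists i].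
have srcR : source R = [set v | v = b \/ exists i, v = fan_point (s i)].
  apply/seteqP; split=> v; first by case=> y [[-> _]|[i [-> _]]]; [left|right; exists i].
  by case=> [->|[i ->]]; [exists b; left|exists (fan_point (t i)); right; exists i].
have tgtR : target R = [set v | v = b \/ exists i, v = fan_point (t i)].
  apply/seteqP; split=> v; first by case=> y [[_ ->]|[i [_ ->]]]; [left|right; exists i].
  by case=> [->|[i ->]]; [exists b; left|exists (fan_point (s i)); right; exists i].
have bP : level b = ln by case: F.
have fb m : fan_point m <> b by move=> E; move: bP; rewrite -E.
have bp m : adjacent b (fan_point m) by case: (flag_fan m).
have bfp m : built (fan_point m).
  by have [SC _] := @fan_strong pred0 pred0 m.+1 (fun _ H => H);
    apply: (closed_built SC); left; right.
exists R; last by move=> i; right; exists i.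
split; rewrite ?srcR ?tgtR ?points; try exact: strong_subfan.
split.
- move=> x y [[-> ->]|[i [-> ->]]] //.
- move=> x y x' y' [[-> ->]|[i [-> ->]]] [[-> ->]|[j [-> ->]]]; split=> //.
  + by split=> [/esym/fb|/esym/fb].
  + by split=> [/fb|/fb].
  + by split=> _; apply: adj_sym.
  + split=> -[] E; congr New.
      by move/(increasing_inj sP): E => ->.
    by move/(increasing_inj tP): E => ->.
  + by split=> A; case: (not_adjacent_level (bfp _) (bfp _) erefl erefl isT A).
- move=> x y x' y' x'' y'' [[-> ->]|[i [-> ->]]]; by rewrite ?bP.
Qed.

End Fan.

Local Notation starts := [set v | exists l, v = Start l].

(** * A line of each colour that is strong by itself *)

Section Base.
Variable i : 'I_k.

(** The letter {0,1,2} gives its line the colour of the index of application, here [i], and attaches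
    nothing to old vertices; this is why the line alone is strong. *)
Definition base_vertex l := New i (Start pl) (Start ln) (Start pt) pt pl l.
Definition base := starts `|` block i (Start pl) (Start ln) (Start pt) pt pl.

Lemma start_unused : unused starts i (Start pl) (Start ln) (Start pt) pt pl.
Proof. by move=> l _ []. Qed.

Lemma base_flag : flag (base_vertex pl) (base_vertex ln) (base_vertex pt).
Proof. by have [_ _ _ ] := built_flag_new_flag i pt pl built_flag_start. Qed.

Lemma base_in l : base (base_vertex l).
Proof. by right; left; exists l => //; elim/level_ind: l. Qed.

Lemma start_flag : flag (Start pl) (Start ln) (Start pt).
Proof. by case: built_flag_start. Qed.

Lemma base_closed : closed base.
Proof.
apply: closed_block; [exact: closed_set_start|by exists pl|by exists ln|by exists pt|].
exact: start_flag.
Qed.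

Lemma base_ext : ext [set base_vertex ln] base.
Proof.
have [|||uF _ _ _ _] := letter_flag closed_set_start _ _ _ start_flag start_unused;
  try by eexists.
apply: (@ext_trans _ (starts `|` [set base_vertex ln])).
  (* The new line is free from the initial flag, which can therefore be built after it. *)
  rewrite -[X in ext X]set0U; apply: ext_free; first exact: ext_set_start.
  exact: (free_over1 uF).
apply: ext_letter_flag; [exact: closed_set_start|by exists pl|by exists ln|by exists pt| |].
  exact: start_flag.
exact: start_unused.
Qed.

Lemma base_new n l :
  ~ base (New n (base_vertex pl) (base_vertex ln) (base_vertex pt) pt pt l).
Proof. by move=> [[]//|[[l' _]|[]]]. Qed.

Lemma base_colour : colour (base_vertex ln) = i.
Proof. by apply: val_inj; rewrite /= modn_small. Qed.

Definition base_point n : vertex :=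
  fan_point (base_vertex pl) (base_vertex ln) (base_vertex pt) n.
Definition base_plane n : vertex :=
  fan_plane (base_vertex pl) (base_vertex ln) (base_vertex pt) n.

Lemma base_expt_flag n :
  expt_flag i (base_plane n) (base_vertex ln) (base_point n).
Proof.
exact: (expt_flag_fan base_closed (base_in _) (base_in _) (base_in _)
  base_flag base_ext base_new n base_colour).
Qed.

Lemma built_fan n : built (base_point n) /\ built (base_plane n).
Proof.
have [S _ _ _] := base_expt_flag n.
by split; apply: (strong_built S); [right|left; left].
Qed.

End Base.

(** * The types and their cycle *)

Definition cycle_point i n : N := exist _ _ (built_fan i n).1.
Definition cycle_plane i n : N := exist _ _ (built_fan i n).2.

Definition cycle_type i : set (formula (cps_sig k) ('I_1 + 'I_1)) :=
  sat (join (fun _ : 'I_1 => cycle_point i 0) (fun _ : 'I_1 => cycle_plane i 0)).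

Lemma expt_flag_cycle_type i b (x y : N) : expt_flag i (sval y) b (sval x) ->
  forall f, sat (join (fun _ : 'I_1 => x) (fun _ : 'I_1 => y)) f <-> cycle_type i f.
Proof.
move=> E f.
have [R [RS Ra Rc]] := expt_flag_iso E (base_expt_flag i 0).
by apply: (same_type f RS) => -[].
Qed.

Lemma cycle_type_expt i n f :
  sat (join (fun _ : 'I_1 => cycle_point i n) (fun _ : 'I_1 => cycle_plane i n)) f
  <-> cycle_type i f.
Proof.
apply: (@expt_flag_cycle_type i (base_vertex i ln)); exact: base_expt_flag.
Qed.

(** Point [m] is ordinary in plane [n] on the line of colour i + 1. In this plane [ordinary_fan]
    supplies a line of colour [i] on which the point is exceptional, and this identifies the
    type. *)
Lemma cycle_type_ordinary i m n f : m != n ->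
  sat (join (fun _ : 'I_1 => cycle_point (ordS i) m)
            (fun _ : 'I_1 => cycle_plane (ordS i) n)) f
  <-> cycle_type i f.
Proof.
rewrite eq_sym => mn.
have [u E] := ordinary_fan (base_closed (ordS i)) (base_in _ _) (base_in _ _)
  (base_in _ _) (base_flag _) (base_ext _) (@base_new (ordS i)) (base_colour _) mn.
by apply: (@expt_flag_cycle_type i u); exact: E.
Qed.

Definition inc_formula i : formula (cps_sig k) ('I_1 + 'I_1) :=
  Inc i (inr ord0) (inl ord0).

Lemma cycle_type_inc i j : cycle_type i (inc_formula j) <-> j = ordS i.
Proof.
have F : flag (base_plane i 0) (base_vertex i ln) (base_point i 0).
  exact: flag_fan_plane (base_flag i) 0 0.
have bb : built (base_vertex i ln) by apply: (closed_built (base_closed i)); apply: base_in.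
have [bc ba] := built_fan i 0.
have BF : built_flag (base_plane i 0) (base_vertex i ln) (base_point i 0) by [].
have lE : label (base_plane i 0) (base_vertex i ln) (base_point i 0) = ordS i.
  by rewrite /label base_colour /shift asboolT // expt_fan.
split=> [[b [F']]|->]; last by exists (base_vertex i ln).
by rewrite (label_uniq F' BF) lE.
Qed.

Lemma cycle_type_inj : injective cycle_type.
Proof.
move=> i j E; apply: (can_inj (@ordSK k)); apply/cycle_type_inc.
by rewrite -E; apply/cycle_type_inc.
Qed.

Lemma cps_not_equational : 1 < k -> ~ equational (CPS k).
Proof.
move=> k_gt1.
(* The fan over the line of colour i + 1 realises the type of index [i] off the diagonal and its
   successor on the diagonal. *)
apply: (@not_equational_of_cycle _ _ N _ cycle_type (fun i => cycle_point (ordS i))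
  (fun i => cycle_plane (ordS i))).
- exact: coloured_model.
- by move=> i f m n mn; apply: cycle_type_ordinary.
- by move=> i f n; apply: cycle_type_expt.
pose i0 : 'I_k := Ordinal k_gt0; exists i0, (ordS i0), (inc_formula (ordS i0)).
split; first exact/cycle_type_inc.
move=> /cycle_type_inc/(can_inj (@ordSK k))/(congr1 val) /=.
by rewrite modn_small.
Qed.

(** The configuration lives in the coloured pseudospace and is carried to a saturated ultrapower by
    [diag], which preserves formulas in finitely many variables. *)
Lemma cps_proper_cycle : has_proper_cycle (CPS k) 1 1 k.
Proof.
have [U [U_ultra U_free]] := ultraFilterLemma eventually_filter.
have [c c_inj] := cps_symbol_code k.
exists (ultrapower N U_ultra); split.
- move=> s /(coloured_model) sN; rewrite /holds.
  by rewrite (@sat_ext _ _ _ _ (diag U_ultra \o of_void N)) ?sat_diag // => -[].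
- have code_inj' : injective (fun f : formula (cps_sig k) (option nat) =>
      pickle (code c (pickle : option nat -> nat) f)).
    move=> f g /(pcan_inj pickleK); apply: (code_inj c_inj).
    exact: pcan_inj pickleK.
  exact (ultrapower_saturated U_free code_inj').
have diag_join (x y : N) f :
    sat (join (fun _ : 'I_1 => diag U_ultra x) (fun _ : 'I_1 => diag U_ultra y)) f <->
    sat (join (fun _ : 'I_1 => x) (fun _ : 'I_1 => y)) f.
  rewrite -[X in _ <-> X](sat_diag U_ultra); by apply: sat_ext => -[].
exists cycle_type; split=> [i|i|]; last exact: cycle_type_inj.
- split=> [p0 p0P _|f].
    exists (join (fun _ : 'I_1 => diag U_ultra (cycle_point i 0))
      (fun _ : 'I_1 => diag U_ultra (cycle_plane i 0))).
    by move=> f /p0P pf; apply/diag_join.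
  by have [|] := pselect (cycle_type i f); [left|right].
(* In this plane point 0 is exceptional and realises the successor type; all later points are
   ordinary and realise the type of index [i]. *)
exists (fun=> diag U_ultra (cycle_plane (ordS i) 0)),
  (fun n _ => diag U_ultra (cycle_point (ordS i) n)).
split.
- move=> n s t sP tP f.
  have [R RS Rst] := fan_indiscernible (base_closed (ordS i)) (base_in _ _)
    (base_in _ _) (base_in _ _) (base_flag _) (base_ext _) (@base_new (ordS i)) sP tP.
  have H (r : 'I_n -> nat) :
      sat (fun z : 'I_n * 'I_1 => diag U_ultra (cycle_point (ordS i) (r z.1))) f <->
      sat (fun z : 'I_n * 'I_1 => cycle_point (ordS i) (r z.1)) f.
    exact: (sat_diag U_ultra f).
  by rewrite !H; apply: (same_type f RS) => z; apply: Rst.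
- by move=> n n_gt0 f pf; apply/diag_join/cycle_type_ordinary => //; rewrite -lt0n.
- by move=> f pf; apply/diag_join/cycle_type_expt.
Qed.

End Colour.

Theorem theorem6p1 (k : nat) (hk : 2 <= k) :
  has_proper_cycle (CPS k) 1 1 k /\ ~ equational (CPS k).
Proof.
have k_gt0 : 0 < k by apply: ltnW.
by split; [apply: cps_proper_cycle|apply: cps_not_equational].
Qed.
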